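(* Let $n\ge1$. Consider the component-wise AND function: Alice has $X\in\{0,1\}^n$, Bob has $Y\in\{0,1\}^n$, Charlie outputs $Z=X\wedge Y$ (bit-wise). For every distribution $p_{XY}$ with full support on $\{0,1\}^n\times\{0,1\}^n$, any secure protocol $\Pi(p_{XY},\text{AND})$ satisfies \[H(M_{31})\ge n\log 3,\quad H(M_{23})\ge n\log 3,\quad H(M_{12})\ge 1.826\,n,\] and $\rho(p_{XY},\text{AND})\ge 1.826\,n$.
   Context: Setting: Alice (party 1) holds $X$, Bob (party 2) holds $Y$, $(X,Y)\sim p_{XY}$ on finite sets; Charlie (party 3) has no input and outputs $Z$, which should equal $f(X,Y)$ for the deterministic function $f$. In a protocol the parties, each with private randomness, exchange messages over multiple rounds on three pairwise private links, each message a codeword of a prefix-free code determined by previous messages on that link; the protocol terminates with probability 1 and may depend on $p_{XY}$. $M_{12},M_{23},M_{31}$ are the final transcripts on the Alice–Bob, Bob–Charlie, Charlie–Alice links; the view $V_i$ of party $i$ consists of the transcripts on its two links plus its input (Alice, Bob) or output (Charlie). A secure protocol satisfies correctness (Charlie outputs $f(x,y)$ on inputs $x,y$) and privacy (Markov chains $(M_{12},M_{31})-X-(Y,Z)$, $(M_{12},M_{23})-Y-(X,Z)$, $(M_{23},M_{31})-Z-(X,Y)$). $\rho(p_{XY},f)=\inf H(V_1,V_2,V_3|X,Y)$ over all secure protocols for $f$ with input distribution $p_{XY}$. Logs base 2. *)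

(* Defs.v *)
From HB Require Import structures.
From mathcomp Require Import all_boot all_order all_algebra.
From mathcomp Require Import all_classical all_reals all_analysis.
Set Implicit Arguments. Unset Strict Implicit. Unset Printing Implicit Defensive.
Import Order.TTheory GRing.Theory Num.Theory.
Local Open Scope classical_set_scope.
Local Open Scope ring_scope.

(* Three-party protocols on pairwise private links (synchronous rounds).     *)
(* Party 1 = Alice (input in A), 2 = Bob (input in B), 3 = Charlie (output   *)
(* in C).  Messages are bit strings.                                         *)

Definition word := seq bool.

(* The history of one link: one pair of messages per round.  For the links   *)
(*   12 : (msg 1->2, msg 2->1)   23 : (msg 2->3, msg 3->2)                    *)
(*   31 : (msg 3->1, msg 1->3)                                               *)
Definition hist := seq (word * word).

Definition transcript (h : hist) : word := flatten [seq p.1 ++ p.2 | p <- h].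

Definition prefix_free (c : word -> bool) : Prop :=
  forall u v, c u -> c v -> prefix u v -> u = v.

Definition is_pmf (R : realType) (T : choiceType) (k : T -> R) : Prop :=
  (forall t, 0 <= k t) /\ (\esum_(t in [set: T]) (k t)%:E = 1)%E.

(* A protocol.  The private randomness of each party is represented by the  *)
(* next-message kernels: the (joint) distribution of the messages a party    *)
(* sends in a round on its two links, given its input and everything it has  *)
(* seen so far on its two links.  Codes for each link direction are functions*)
(* of the previous messages on that link.                                    *)
Record protocol (R : realType) (A B C : finType) := Protocol {
  code12 : hist -> word -> bool;
  code21 : hist -> word -> bool;
  code23 : hist -> word -> bool;
  code32 : hist -> word -> bool;
  code31 : hist -> word -> bool;
  code13 : hist -> word -> bool;
  (* Alice: x, h12, h31 |-> law of (msg to Bob, msg to Charlie) *)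
  alice : A -> hist -> hist -> word * word -> R;
  (* Bob: y, h12, h23 |-> law of (msg to Alice, msg to Charlie) *)
  bob : B -> hist -> hist -> word * word -> R;
  (* Charlie: h23, h31 |-> law of (msg to Bob, msg to Alice) *)
  charlie : hist -> hist -> word * word -> R;
  (* Charlie's output, given the final transcripts m23, m31 *)
  output : word -> word -> C -> R
}.

Definition wf_protocol (R : realType) (A B C : finType)
    (P : protocol R A B C) : Prop :=
  [/\ (forall h, prefix_free (code12 P h)), (forall h, prefix_free (code21 P h))
    & (forall h, prefix_free (code23 P h))]
  /\ [/\ (forall h, prefix_free (code32 P h)),
      (forall h, prefix_free (code31 P h)) & (forall h, prefix_free (code13 P h))]
  /\ [/\ (forall x h12 h31, is_pmf (alice P x h12 h31)
          /\ forall w, alice P x h12 h31 w != 0 ->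
                code12 P h12 w.1 /\ code13 P h31 w.2),
      (forall y h12 h23, is_pmf (bob P y h12 h23)
          /\ forall w, bob P y h12 h23 w != 0 ->
                code21 P h12 w.1 /\ code23 P h23 w.2),
      (forall h23 h31, is_pmf (charlie P h23 h31)
          /\ forall w, charlie P h23 h31 w != 0 ->
                code32 P h23 w.1 /\ code31 P h31 w.2)
    & (forall m23 m31, (forall z, 0 <= output P m23 m31 z) /\
                       \sum_z output P m23 m31 z = 1)].

Definition round_prob (R : realType) (A B C : finType) (P : protocol R A B C)
    (x : A) (y : B) (h12 h23 h31 : hist) (r12 r23 r31 : word * word) : R :=
  alice P x h12 h31 (r12.1, r31.2) * bob P y h12 h23 (r12.2, r23.1)
  * charlie P h23 h31 (r23.2, r31.1).

Definition hist_prob (R : realType) (A B C : finType) (P : protocol R A B C)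
    (x : A) (y : B) (T : nat) (H12 H23 H31 : hist) : R :=
  if [&& size H12 == T, size H23 == T & size H31 == T] then
    \prod_(t < T) round_prob P x y (take t H12) (take t H23) (take t H31)
        (nth ([::], [::]) H12 t) (nth ([::], [::]) H23 t) (nth ([::], [::]) H31 t)
  else 0.

Definition partial_prob (R : realType) (A B C : finType) (P : protocol R A B C)
    (x : A) (y : B) (T : nat) (m : word * word * word) : \bar R :=
  \esum_(H in [set H : hist * hist * hist |
            [/\ transcript H.1.1 = m.1.1, transcript H.1.2 = m.1.2
              & transcript H.2 = m.2]])
    (hist_prob P x y T H.1.1 H.1.2 H.2)%:E.

Definition final_prob (R : realType) (A B C : finType) (P : protocol R A B C)
    (x : A) (y : B) (m : word * word * word) : \bar R :=
  limn (fun T => partial_prob P x y T m).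

(* termination with probability 1: the final transcripts are (finite       *)
(* strings) with total probability 1, on every input                        *)
Definition terminates (R : realType) (A B C : finType) (P : protocol R A B C) :=
  forall x y, (\esum_(m in [set: word * word * word]) final_prob P x y m = 1)%E.

Definition outcome (A B C : finType) := (A * B * C * (word * word * word))%type.

Definition joint (R : realType) (A B C : finType) (pXY : A -> B -> R)
    (P : protocol R A B C) (o : outcome A B C) : \bar R :=
  let: (x, y, z, m) := o in
  ((pXY x y)%:E * final_prob P x y m * (output P m.1.2 m.2 z)%:E)%E.

Definition oX A B C (o : outcome A B C) := o.1.1.1.
Definition oY A B C (o : outcome A B C) := o.1.1.2.
Definition oZ A B C (o : outcome A B C) := o.1.2.
Definition oM12 A B C (o : outcome A B C) := o.2.1.1.
Definition oM23 A B C (o : outcome A B C) := o.2.1.2.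
Definition oM31 A B C (o : outcome A B C) := o.2.2.
Definition oV1 A B C (o : outcome A B C) := (oX o, oM12 o, oM31 o).
Definition oV2 A B C (o : outcome A B C) := (oY o, oM12 o, oM23 o).
Definition oV3 A B C (o : outcome A B C) := (oZ o, oM23 o, oM31 o).

Definition law (R : realType) (O V : choiceType) (Pr : O -> \bar R)
    (U : O -> V) (v : V) : \bar R :=
  \esum_(o in [set o | U o = v]) Pr o.

Definition log2 (R : realType) (t : R) : R := ln t / ln 2.

Definition entropy (R : realType) (O V : choiceType) (Pr : O -> \bar R)
    (U : O -> V) : \bar R :=
  \esum_(v in [set: V])
    (let q := fine (law Pr U v) in if q == 0 then 0 else - (q * log2 q))%:E.

Definition cond_entropy (R : realType) (O V W : choiceType) (Pr : O -> \bar R)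
    (U : O -> V) (Wv : O -> W) : \bar R :=
  \esum_(uw in [set: V * W])
    (let q := fine (law Pr (fun o => (U o, Wv o)) uw) in
     let r := fine (law Pr Wv uw.2) in
     if q == 0 then 0 else q * log2 (r / q))%:E.

Definition markov (R : realType) (O V1 V2 V3 : choiceType) (Pr : O -> \bar R)
    (U : O -> V1) (V : O -> V2) (W : O -> V3) : Prop :=
  forall u v w,
    (law Pr (fun o => (U o, V o, W o)) (u, v, w) * law Pr V v
     = law Pr (fun o => (U o, V o)) (u, v) * law Pr (fun o => (V o, W o)) (v, w))%E.

Definition correct (R : realType) (A B C : finType) (f : A -> B -> C)
    (P : protocol R A B C) : Prop :=
  forall x y m z,
    (final_prob P x y m * (output P m.1.2 m.2 z)%:E != 0)%E -> z = f x y.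

Definition secure (R : realType) (A B C : finType) (pXY : A -> B -> R)
    (f : A -> B -> C) (P : protocol R A B C) : Prop :=
  [/\ wf_protocol P, terminates P, correct f P
    & let Pr := joint pXY P in
      [/\ markov Pr (fun o => (oM12 o, oM31 o)) (@oX A B C)
                    (fun o => (oY o, oZ o)),
          markov Pr (fun o => (oM12 o, oM23 o)) (@oY A B C)
                    (fun o => (oX o, oZ o))
        & markov Pr (fun o => (oM23 o, oM31 o)) (@oZ A B C)
                    (fun o => (oX o, oY o))]].

Definition view_entropy (R : realType) (A B C : finType) (pXY : A -> B -> R)
    (P : protocol R A B C) : \bar R :=
  cond_entropy (joint pXY P) (fun o => (oV1 o, oV2 o, oV3 o))
    (fun o => (oX o, oY o)).

Definition rho (R : realType) (A B C : finType) (pXY : A -> B -> R)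
    (f : A -> B -> C) : \bar R :=
  ereal_inf [set e | exists P : protocol R A B C,
                       secure pXY f P /\ e = view_entropy pXY P].

Definition bits (n : nat) := {ffun 'I_n -> bool}.
Definition AND (n : nat) (x y : bits n) : bits n := [ffun i => x i && y i].

(* Main.v *)
(* Write m12, m23, m31 for the final transcripts.  Unique decoding of the links
   turns the final law into a product al_x(m12,m31) be_y(m12,m23) ga(m23,m31), and
   privacy makes the law of each single transcript independent of the inputs, so
   the inputs may be drawn from any convenient law.  Take the 3^n pairs y <= x
   with equal weight: then z = y, and (x,y) is a function of the three transcripts.

   H(M31) >= n log 3: given m23, the transcript m31 reveals z = y, and then,
   together with m12, which is no help given (m23,y), it reveals x.

   H(M12) >= n (log 3 + 1/3) > 1.826 n: one bound is
   H(M12) >= I(M12;M31|X) + E #{i : x_i = 0}.  For the first term, each link law p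
   is bounded by a product f.g of the causal conditional probabilities of the
   party that speaks first in a round and of the one that answers.  The functions
   al.g12.f31, be.g23.f12 and ga.g31.f23 are then sub-probabilities, since each is
   the law of an interaction of one party with two correspondents who each look
   at their own link only; comparing the true marginals with these laws gives
   I(M12;M31|X) >= n log 3.
   The weaker choice of independent X and Y would only give 1.82599 n. *)
Require Import Defs.
From HB Require Import structures.
From mathcomp Require Import all_boot all_order all_algebra.
From mathcomp Require Import all_classical all_reals all_analysis.
From mathcomp Require Import ring lra.
Set Implicit Arguments. Unset Strict Implicit. Unset Printing Implicit Defensive.
Import Order.TTheory GRing.Theory Num.Theory numFieldNormedType.Exports.
Local Open Scope classical_set_scope.
Local Open Scope ring_scope.

(** The transcripts form an infinite set and the number of rounds is unbounded, so an entropy may be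
    [+oo] and a mutual information cannot be written as a difference of entropies. Each information
    inequality is therefore obtained pointwise, from [ln t <= t - 1] for a density ratio [t] of mean
    at most 1. Alice's factor [al] is a product of her next-message probabilities along given
    transcripts. It is not a law: a sum over both of her links also runs over the messages that she
    receives. Filling these in by causal conditional laws makes it a sub-probability. The links are
    oriented cyclically, 1 to 2 to 3 to 1, so that every party speaks first on one link and answers
    on the other; one argument then serves all three parties, and together they use each of the six
    factors [f], [g] exactly once. The constant leaves some room: [log2 3 >= 3/2] is enough, since
    3/2 + 1/3 = 1.8333... *)

Section esum_extra.
Context {R : realType}.
Local Open Scope ereal_scope.

(** * Sums over infinite types with values in the extended reals *)

Lemma esumZl (T : choiceType) (r : R) (a : T -> \bar R) :
  (0 <= r)%R -> (forall t, 0 <= a t) ->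
  \esum_(t in [set: T]) (r%:E * a t) = r%:E * \esum_(t in [set: T]) a t.
Proof.
move=> r0 a0; rewrite /esum -ereal_supZl //; last first.
  by apply/set0P; exists 0; exists set0; [exact: fsets_set0|rewrite fsbig_set0].
congr (ereal_sup _); apply/seteqP; split=> [_ [A SA <-]|_ [_ [A SA <-] <-]] /=.
  by exists (\sum_(x \in A) a x); [exists A|rewrite ge0_mule_fsumr].
by exists A => //; rewrite ge0_mule_fsumr.
Qed.

Lemma esum_pair (T1 T2 : choiceType) (a : T1 * T2 -> \bar R) :
  (forall t, 0 <= a t) ->
  \esum_(t in [set: T1 * T2]) a t =
  \esum_(i in [set: T1]) \esum_(j in [set: T2]) a (i, j).
Proof.
move=> a0; rewrite esum_esum //; apply: esym.
rewrite (_ : _ `*`` _ = setT); last by apply/seteqP; split.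
by apply: eq_esum => -[].
Qed.

Lemma esum_exchange (T1 T2 : choiceType) (a : T1 -> T2 -> \bar R) :
  (forall i j, 0 <= a i j) ->
  \esum_(i in [set: T1]) \esum_(j in [set: T2]) a i j =
  \esum_(j in [set: T2]) \esum_(i in [set: T1]) a i j.
Proof.
move=> a0; rewrite -(esum_pair (a := fun t => a t.1 t.2)) //.
rewrite -(esum_pair (a := fun t => a t.2 t.1)) //.
apply: (reindex_esum setT setT (fun t : T2 * T1 => (t.2, t.1))).
by split => //= [[? ?] [? ?] _ _ [-> ->] //|[i j] _]; exists (j, i).
Qed.

Lemma esum_single (T : choiceType) (t : T) (a : T -> \bar R) :
  0 <= a t -> (forall i, i != t -> a i = 0) ->
  \esum_(i in [set: T]) a i = a t.
Proof.
move=> at0 a0; rewrite -(esum_set1 at0) [RHS]esum_mkcond; apply: eq_esum => i _.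
by case: ifPn => // /negP; rewrite inE /= => /eqP/a0.
Qed.

Lemma esum_fin (T : finType) (a : T -> \bar R) :
  (forall t, 0 <= a t) -> \esum_(t in [set: T]) a t = \sum_t a t.
Proof.
move=> a0; rewrite -[in LHS](_ : [set` finset.setT] = [set: T]); last first.
  by apply/seteqP; split => // t _ /=; rewrite finset.in_setT.
rewrite -(eq_esum (a := fun t => \sum_(s | s == t) a s)); last first.
  by move=> i _; rewrite big_pred1_eq.
rewrite (eq_esum (b := fun i => \sum_s if s == i then a s else 0)); last first.
  by move=> i _; rewrite big_mkcond.
rewrite esum_sum; last by move=> i j _ _; case: ifP.
apply: eq_bigr => s _.
rewrite esum_mkcond (esum_single (t := s)) ?eqxx.
- by rewrite ifT // inE /= finset.in_setT.
- by case: ifP.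
- by move=> i /negbTE si; rewrite eq_sym si; case: ifP.
Qed.

Lemma le_esum_term (T : choiceType) (a : T -> \bar R) t :
  (forall i, 0 <= a i) -> a t <= \esum_(i in [set: T]) a i.
Proof.
move=> a0; have <- : \esum_(i in [set: T]) (if i == t then a i else 0) = a t.
  rewrite (esum_single (t := t)) ?eqxx //.
  by move=> i /negbTE ->.
by apply: le_esum => i _; case: ifP.
Qed.

Lemma law_sum (O V : choiceType) (f : O -> \bar R) (U : O -> V) (g : V -> R) :
  (forall t, 0 <= f t) -> (forall v, (0 <= g v)%R) ->
  \esum_(o in [set: O]) (f o * (g (U o))%:E) =
  \esum_(v in [set: V]) (law f U v * (g v)%:E).
Proof.
move=> f0 g0.
rewrite [RHS](eq_esum (b := fun v => \esum_(o in [set: O])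
    if U o == v then f o * (g v)%:E else 0)); last first.
  move=> v _; rewrite /law muleC esum_mkcond -esumZl //; last by move=> o; case: ifP.
  apply: eq_esum => o _; case: ifPn => [|/negP]; rewrite inE /=.
    by move=> ->; rewrite eqxx muleC.
  by move=> /eqP/negbTE ->; rewrite mule0.
rewrite esum_exchange; last by move=> *; case: ifP => // _; rewrite mule_ge0 ?lee_fin.
apply: eq_esum => o _; rewrite (esum_single (t := U o)) ?eqxx //.
  by rewrite mule_ge0 ?lee_fin.
by move=> v /negbTE; rewrite eq_sym => ->.
Qed.

Lemma esum_fset_le (T : choiceType) (a : T -> \bar R) (k : \bar R) :
  (forall t, 0 <= a t) ->
  (forall s : seq T, uniq s -> \sum_(t <- s) a t <= k) ->
  \esum_(t in [set: T]) a t <= k.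
Proof.
move=> a0 H; apply: ge_ereal_sup => _ [A [finA _] <-].
by rewrite fsbig_finite //= H.
Qed.

Lemma sum_le_esum (T : choiceType) (a : T -> \bar R) (s : seq T) :
  (forall t, 0 <= a t) -> uniq s ->
  \sum_(t <- s) a t <= \esum_(t in [set: T]) a t.
Proof.
move=> a0 us; apply: esum_ge; exists [set` s]; first by split.
rewrite fsbig_finite //= (perm_big (finmap.enum_fset (fset_set [set` s]))) //=.
by apply: uniq_perm => //= t; rewrite in_fset_set // mem_setE.
Qed.

(* A weak form of Jensen's inequality in which every sum has nonnegative terms,
   so that no expectation has to be finite: it is applied with [ln t <= t - 1]. *)
Lemma gibbs (T : choiceType) (p F G t : T -> R) (k N : R) :
  (forall i, 0 <= p i)%R -> \esum_(i in [set: T]) (p i)%:E = 1 ->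
  (forall i, 0 <= F i)%R -> (forall i, 0 <= G i)%R ->
  (forall i, 0 <= t i)%R -> (0 <= k)%R -> (0 <= N)%R ->
  \esum_(i in [set: T]) (p i * t i)%:E <= N%:E ->
  (forall i, 0 < p i -> G i + k + N <= F i + t i)%R ->
  \esum_(i in [set: T]) (p i * G i)%:E + k%:E
    <= \esum_(i in [set: T]) (p i * F i)%:E.
Proof.
move=> p0 p1 F0 G0 t0 k0 N0 tN H.
(* The finite [N] is added to both sides and cancelled at the end, which is legitimate even if the
   two sums are infinite. *)
have : \esum_(i in [set: T]) (p i * G i)%:E + (k + N)%:E <=
       \esum_(i in [set: T]) (p i * F i)%:E + N%:E.
  apply: le_trans (leeD2l _ tN); rewrite -esumD; last 2 first.
  - by move=> i _; rewrite lee_fin mulr_ge0.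
  - by move=> i _; rewrite lee_fin mulr_ge0.
  have kN : (0 <= k + N)%R by rewrite addr_ge0.
  rewrite -[X in _ + X]mule1 -p1 -esumZl // -esumD; last 2 first.
  - by move=> i _; rewrite lee_fin mulr_ge0.
  - by move=> i _; rewrite -EFinM lee_fin mulr_ge0.
  apply: le_esum => i _; rewrite -EFinM -!EFinD lee_fin.
  rewrite [((k + N) * _)%R]mulrC -!mulrDr.
  have := p0 i; rewrite le_eqVlt => /orP[/eqP <-|pi0]; first by rewrite !mul0r.
  by rewrite ler_pM2l // addrA; exact: H.
by rewrite EFinD addeA leeD2rE.
Qed.

End esum_extra.

(** * Laws of functions of an outcome *)

Section law_extra.
Context {R : realType}.
Local Open Scope ereal_scope.

(** The form in which decodability is used: where the transcripts determine the remaining data,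
    projecting to the transcripts is injective, so a sum over all data is bounded by a sum over
    transcripts alone. *)
Lemma esum_inj_le (T T' : choiceType) (S : set T) (e : T -> T')
    (f : T -> \bar R) (h : T' -> \bar R) :
  set_inj S e -> (forall t, 0 <= h t) -> (forall t, S t -> f t <= h (e t)) ->
  \esum_(t in S) f t <= \esum_(t in [set: T']) h t.
Proof.
move=> injS h0 fh; apply: (@le_trans _ _ (\esum_(t in S) h (e t))).
  exact: le_esum.
rewrite -(esum_image S e h) // esum_mkcond.
by apply: le_esum => t _; case: ifP.
Qed.

Lemma law_ge0 (O V : choiceType) (f : O -> \bar R) (U : O -> V) v :
  (forall o, 0 <= f o) -> 0 <= law f U v.
Proof. by move=> f0; apply: esum_ge0. Qed.

Lemma lawE (O V : choiceType) (f : O -> \bar R) (U : O -> V) v :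
  law f U v = \esum_(o in [set: O]) (f o * (if U o == v then 1 else 0)%:E).
Proof.
rewrite /law esum_mkcond; apply: eq_esum => o _.
case: ifPn => [/set_mem /= ->|/negP]; first by rewrite eqxx mule1.
by rewrite inE /= => /eqP/negbTE ->; rewrite mule0.
Qed.

Lemma law_comp (O V T : choiceType) (f : O -> \bar R) (U : O -> V) (h : V -> T) t :
  (forall o, 0 <= f o) -> law (law f U) h t = law f (h \o U) t.
Proof.
move=> f0; rewrite !lawE.
rewrite -(law_sum (f := f) U (g := fun v => if h v == t then 1 else 0)%R) //.
by move=> v; case: ifP.
Qed.

Lemma law_term (O V : choiceType) (f : O -> \bar R) (U : O -> V) o :
  (forall o, 0 <= f o) -> f o <= law f U (U o).
Proof.
move=> f0; rewrite lawE; apply: le_trans (le_esum_term o _) => /=.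
  by rewrite eqxx mule1.
by move=> i; case: ifP; rewrite ?mule1 ?mule0.
Qed.

(** Meant for a variable that contains the inputs: once these are fixed, comparing them with a
    target is a constant boolean [b], and only the transcript part stays random. *)
Lemma law_mask (O V V' : choiceType) (f : O -> \bar R) (U : O -> V) (U' : O -> V') v v' b :
  (forall o, (U o == v) = b && (U' o == v')) ->
  law f U v = if b then law f U' v' else 0.
Proof.
move=> H; rewrite !lawE; case: b H => H.
  by apply: eq_esum => o _; rewrite H.
by apply: esum1 => o _; rewrite H mule0.
Qed.

Lemma law_le_total (O V : choiceType) (f : O -> \bar R) (U : O -> V) v :
  (forall o, 0 <= f o) -> law f U v <= \esum_(o in [set: O]) f o.
Proof.
by move=> f0; rewrite /law esum_mkcond; apply: le_esum => o _; case: ifP.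
Qed.

Lemma esum_law (O V : choiceType) (f : O -> \bar R) (U : O -> V) :
  (forall o, 0 <= f o) ->
  \esum_(v in [set: V]) law f U v = \esum_(o in [set: O]) f o.
Proof.
move=> f0; have := @law_sum R O V f U (fun=> 1%R) f0 (fun=> ler01).
under eq_esum do rewrite mule1.
by move=> ->; apply: eq_esum => v _; rewrite mule1.
Qed.

Lemma law_snd (T1 T2 : choiceType) (f : T1 * T2 -> \bar R) t :
  (forall o, 0 <= f o) -> law f snd t = \esum_(s in [set: T1]) f (s, t).
Proof.
move=> f0; rewrite lawE esum_pair; last by move=> i; case: ifP; rewrite ?mule1 ?mule0.
apply: eq_esum => s _; rewrite (esum_single (t := t)) /= ?eqxx ?mule1 //.
by move=> i /negbTE ->; rewrite mule0.
Qed.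

Lemma esum_triple (T1 T2 T3 : choiceType) (h : T1 * T2 * T3 -> \bar R) :
  (forall m, 0 <= h m) ->
  \esum_(m in [set: T1 * T2 * T3]) h m =
  \esum_(b in [set: T2]) \esum_(c in [set: T3]) \esum_(a in [set: T1]) h (a, b, c).
Proof.
move=> h0; rewrite esum_pair // esum_pair; last by move=> t; apply: esum_ge0.
rewrite esum_exchange; last by move=> i j; apply: esum_ge0.
by apply: eq_esum => b _; rewrite esum_exchange.
Qed.

(** Change of measure: the mean of [q / p] under [p] is the mass that [q] gives to the support of
    [p]. *)
Lemma density_le (O V : choiceType) (f : O -> \bar R) (U : O -> V) (p q : V -> R) :
  (forall o, 0 <= f o) -> (forall v, 0 <= q v)%R -> (forall v, 0 <= p v)%R ->
  (forall v, law f U v = (p v)%:E) ->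
  \esum_(o in [set: O]) (f o * (q (U o) / p (U o))%:E)
    <= \esum_(v in [set: V]) (q v)%:E.
Proof.
move=> f0 q0 p0 fp.
rewrite (@law_sum _ _ _ f U (fun v => q v / p v)%R) //; last first.
  by move=> v; rewrite divr_ge0.
apply: le_esum => v _; rewrite fp -EFinM lee_fin mulrCA.
(* Where [p v] vanishes, the quotient is 0 by convention, and the mass [q v] is simply lost. *)
have [->|pv] := eqVneq (p v) 0%R; first by rewrite mul0r mulr0.
by rewrite divff ?mulr1.
Qed.

End law_extra.

(** * Ternary words as input pairs *)

Section triples.
Variable n : nat.

(* [v i] encodes the [i]-th bits of a pair [y <= x]: the input pair is [(0,0)],
   [(1,0)] or [(1,1)] according to [v i = 0, 1, 2]. *)
Definition xin (v : {ffun 'I_n -> 'I_3}) : bits n := [ffun i => v i != 0 :> nat].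
Definition yin (v : {ffun 'I_n -> 'I_3}) : bits n := [ffun i => v i == 2 :> nat].

Lemma AND_xin_yin v : AND (xin v) (yin v) = yin v.
Proof. by apply/ffunP => i; rewrite !ffunE; case: (v i) => -[|[|[]]]. Qed.

Lemma xin_yin_inj v w : xin v = xin w -> yin v = yin w -> v = w.
Proof.
move=> /ffunP xe /ffunP ye; apply/ffunP => i; apply/val_inj.
move: (xe i) (ye i); rewrite !ffunE.
by case: (v i) (w i) => -[|[|[|//]]] ? [[|[|[|//]]]] ?.
Qed.

Lemma card_triples : #|{: {ffun 'I_n -> 'I_3}}| = (3 ^ n)%N.
Proof. by rewrite card_ffun !card_ord. Qed.

Definition zeros (x : bits n) : nat := (\sum_(i < n) ~~ x i)%N.

(** Bit [i] of [y] is forced to be false where [x i] holds and is free elsewhere, so the set is a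
    product of singletons and full two-point sets. *)
Lemma card_below (x : bits n) :
  #|[pred y : bits n | [forall i, y i ==> ~~ x i]]| = (2 ^ zeros x)%N.
Proof.
pose F (i : 'I_n) := [pred b : bool | b ==> ~~ x i].
rewrite -(@eq_card _ (family F)); last first.
  by move=> y; rewrite !inE; apply/familyP/forallP => H i; have := H i; rewrite !inE.
rewrite card_family foldrE big_map big_enum /= /zeros expn_sum; 
apply: eq_big => [i|i _] /=; first by rewrite inE.
rewrite /F; case: (x i) => /=.
  by rewrite (@eq_card _ _ (pred1 false)) ?card1 // => -[].
by rewrite (@eq_card _ _ predT) ?card_bool // => -[].
Qed.

(** Double counting: at each position exactly a third of the ternary words carry the letter 0, the
    only letter that makes the bit of [x] zero. This is the origin of the summand 1/3 in the bound
    for the Alice-Bob link. *)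
Lemma sum_zeros : (\sum_(v : {ffun 'I_n -> 'I_3}) zeros (xin v) * 3 = n * 3 ^ n)%N.
Proof.
rewrite -big_distrl /= exchange_big /= big_distrl /=.
have -> : (n * 3 ^ n = \sum_(i < n) 3 ^ n)%N by rewrite sum_nat_const card_ord.
apply: eq_bigr => i _.
pose F (j : 'I_n) := [pred b : 'I_3 | (j == i) ==> (b == ord0)].
have -> : (\sum_(v : {ffun 'I_n -> 'I_3}) ~~ xin v i = #|family F|)%N.
  rewrite -sum1_card [RHS]big_mkcond; apply: eq_bigr => v _.
  rewrite ffunE negbK; case: ifPn => [/familyP/(_ i)|/negP H].
    by rewrite !inE eqxx /= => /eqP ->.
  case: eqP => // vi; case: H; apply/familyP => j; rewrite !inE.
  by apply/implyP => /eqP ->; apply/eqP/val_inj.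
have -> : (3 ^ n = \prod_(j < n) 3)%N by rewrite prod_nat_const card_ord.
rewrite card_family foldrE big_map big_enum /= (bigD1 i) //= [RHS](bigD1 i) //=.
rewrite (@eq_card _ (F i) (pred1 ord0)) ?card1; last by move=> b; rewrite !inE eqxx.
rewrite mul1n mulnC; congr (_ * _)%N; apply: eq_bigr => j /negbTE ji.
by rewrite (@eq_card _ _ predT) ?card_ord // => b; rewrite !inE ji.
Qed.
End triples.

Lemma ln_le_subr1 (R : realType) (t : R) : 0 < t -> ln t <= t - 1.
Proof. by move=> t0; have := @le_ln1Dx R (t - 1); rewrite [1 + _]addrC subrK; apply; lra. Qed.

(** * Transcript laws averaged over random inputs *)

Section mixture.
Context {R : realType} {I : finType} {M : choiceType}.
Variables (w : I -> R) (q : I -> M -> R).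
Hypotheses (w_ge0 : forall i, 0 <= w i) (w_sum : \sum_i w i = 1).
Hypothesis q_ge0 : forall i m, 0 <= q i m.

Definition mix (o : I * M) : R := w o.1 * q o.1 o.2.

Lemma mix_ge0 o : 0 <= mix o.
Proof. by rewrite mulr_ge0. Qed.

Lemma mix_gt0 o : 0 < mix o -> 0 < q o.1 o.2.
Proof.
move=> mo; rewrite lt_neqAle q_ge0 andbT eq_sym; apply: contraTneq mo => q0.
by rewrite /mix q0 mulr0 ltxx.
Qed.

Lemma esum_mix (F : I -> M -> R) : (forall i m, 0 <= F i m) ->
  (\esum_(o in [set: I * M]) (mix o * F o.1 o.2)%:E
   = \sum_i (w i)%:E * \esum_(m in [set: M]) (q i m * F i m)%:E)%E.
Proof.
move=> F0; rewrite esum_pair; last by move=> t; rewrite lee_fin mulr_ge0 // mix_ge0.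
rewrite -esum_fin; last first.
  by move=> i; rewrite mule_ge0 ?lee_fin //; apply: esum_ge0 => m _; rewrite lee_fin mulr_ge0.
apply: eq_esum => i _; rewrite -esumZl //; last by move=> m; rewrite lee_fin mulr_ge0.
by apply: eq_esum => m _; rewrite -EFinM /mix /= mulrA.
Qed.

(** A conditional mean that is the same for all inputs is also the overall mean. The constant [K] is
    an extended real because it will be an entropy, possibly [+oo]. *)
Lemma esum_mix_cst (F : I -> M -> R) (K : \bar R) : (forall i m, 0 <= F i m) ->
  (0 <= K)%E -> (forall i, w i != 0%R -> \esum_(m in [set: M]) (q i m * F i m)%:E = K)%E ->
  (\esum_(o in [set: I * M]) (mix o * F o.1 o.2)%:E = K)%E.
Proof.
move=> F0 K0 FK; rewrite esum_mix // (eq_bigr (fun i => (w i)%:E * K)%E); last first.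
  by move=> i _; have [->|/FK ->//] := eqVneq (w i) 0; rewrite !mul0e.
rewrite -ge0_sume_distrl; last by move=> i _; rewrite lee_fin.
by rewrite sumEFin w_sum mul1e.
Qed.

Lemma esum_mix_le (F : I -> M -> R) (K : \bar R) : (forall i m, 0 <= F i m) ->
  (forall i, \esum_(m in [set: M]) (q i m * F i m)%:E <= K)%E ->
  (\esum_(o in [set: I * M]) (mix o * F o.1 o.2)%:E <= K)%E.
Proof.
move=> F0 FK; rewrite esum_mix //.
apply: (@le_trans _ _ (\sum_i (w i)%:E * K)%E).
  by apply: lee_sum => i _; rewrite lee_wpmul2l ?lee_fin.
rewrite -ge0_sume_distrl; last by move=> i _; rewrite lee_fin.
by rewrite sumEFin w_sum mul1e.
Qed.

Lemma mix_total :
  (forall i, w i != 0%R -> \esum_(m in [set: M]) (q i m)%:E = 1)%E ->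
  (\esum_(o in [set: I * M]) (mix o)%:E = 1)%E.
Proof.
move=> q1; rewrite -(@esum_mix_cst (fun _ _ => 1) 1%E) //.
  by apply: eq_esum => o _; rewrite mulr1.
by move=> i /q1 <-; apply: eq_esum => m _; rewrite mulr1.
Qed.

Lemma law_mix (T : choiceType) (U : M -> T) t :
  (law (EFin \o mix) (U \o snd) t = \sum_i (w i)%:E * law (EFin \o q i) U t)%E.
Proof.
rewrite lawE; have F0 (i : I) m : 0 <= (if U m == t then 1 else 0) :> R by case: ifP.
by apply: etrans (esum_mix F0) _; apply: eq_bigr => i _; rewrite lawE.
Qed.

End mixture.

(** * Entropy of a link of Charlie *)

Section support.
Context {R : realType} {n : nat} {W1 W2 W3 : choiceType}.
Variables (Q : bits n -> bits n -> W1 * W2 * W3 -> R).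
Variables (p2 : bits n -> W1 * W2 -> R) (p23 : W2 -> R) (p31 : W3 -> R).
Hypothesis Q_ge0 : forall x y m, 0 <= Q x y m.
Hypothesis Q_total : forall x y, (\esum_(m in [set: W1 * W2 * W3]) (Q x y m)%:E = 1)%E.
Hypothesis determines_x : forall x y x' y' a b b' c,
  Q x y (a, b, c) != 0 -> Q x' y' (a, b', c) != 0 -> x = x'.
Hypothesis determines_z : forall x y x' y' a a' b c,
  Q x y (a, b, c) != 0 -> Q x' y' (a', b, c) != 0 -> AND x y = AND x' y'.
Hypothesis p2_ge0 : forall y w, 0 <= p2 y w.
Hypothesis p2_sum : forall y b, (\esum_(a in [set: W1]) (p2 y (a, b))%:E = (p23 b)%:E)%E.

Local Notation V := {ffun 'I_n -> 'I_3}.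
Local Notation Qv v := (Q (xin v) (yin v)).

Definition triple_weight : V -> R := fun=> 3 ^- n.

Lemma triple_weight_ge0 v : 0 <= triple_weight v.
Proof. by rewrite invr_ge0 exprn_ge0. Qed.

Lemma triple_weight_sum : \sum_v triple_weight v = 1.
Proof.
by rewrite sumr_const card_triples -[LHS]mulr_natl natrX mulfV // expf_neq0 ?pnatr_eq0.
Qed.

Definition triple_joint : V * (W1 * W2 * W3) -> R := mix triple_weight (fun v => Qv v).

(** For a pair [y <= x] the output is [y] itself, so Charlie's two transcripts reveal [y]. *)
Lemma triple_unique v v' a a' b c :
  Qv v (a, b, c) != 0 -> Qv v' (a', b, c) != 0 -> yin v = yin v'.
Proof. by move=> Hv /(determines_z Hv); rewrite !AND_xin_yin. Qed.

(** On the support the transcripts determine [v]: [(a, c)] gives [x] and [(b, c)] gives [y]. Hence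
    each transcript triple is counted at most once, with a [y] that depends on [(b, c)] only, and
    [a] can be summed out of [p2]. *)
Lemma support_sum (g : W2 * W3 -> R) : (forall w, 0 <= g w) ->
  (\esum_(o in [set: V * (W1 * W2 * W3)])
     (if Qv o.1 o.2 == 0 then 0
      else p2 (yin o.1) o.2.1 * g (o.2.1.2, o.2.2))%:E
   <= \esum_(b in [set: W2]) \esum_(c in [set: W3]) (p23 b * g (b, c))%:E)%E.
Proof.
move=> g0.
(* The [y] read off from Charlie's two transcripts. The default value for impossible pairs is
   harmless, because [p2 y] has the same marginal on [b] for every [y]. *)
pose y0 (w : W2 * W3) : bits n :=
  xget [ffun=> false] [set y | exists v a, y = yin v /\ Qv v (a, w.1, w.2) != 0].
have y0E v a b c : Qv v (a, b, c) != 0 -> y0 (b, c) = yin v.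
  move=> Hv; rewrite /y0 /=; case: xgetP => [_ _ [v' [a' [-> Hv']]]|].
    exact: triple_unique Hv' Hv.
  by move=> /(_ (yin v)) []; exists v, a.
pose h (m : W1 * W2 * W3) := p2 (y0 (m.1.2, m.2)) m.1 * g (m.1.2, m.2).
have h0 m : 0 <= h m by rewrite mulr_ge0.
pose S := [set o : V * (W1 * W2 * W3) | Qv o.1 o.2 != 0].
apply: (@le_trans _ _ (\esum_(m in [set: W1 * W2 * W3]) (h m)%:E)%E).
  rewrite (eq_esum (b := fun o => if o \in S then
      (p2 (yin o.1) o.2.1 * g (o.2.1.2, o.2.2))%:E else 0%E)); last first.
    move=> o _; case: ifPn => [Q0|Qn].
      by rewrite memNset // /S /= Q0.
    by rewrite mem_set.
  rewrite -esum_mkcond; apply: (@esum_inj_le _ _ _ _ snd).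
  - move=> [v [[a b] c]] [v' [[a' b'] c']] /set_mem /= Hv /set_mem /= Hv' [? ? ?]; subst.
    by congr (_, _); apply: xin_yin_inj; [apply: determines_x Hv Hv'|apply: triple_unique Hv Hv'].
  - by move=> m; rewrite lee_fin.
  - by move=> [v [[a b] c]] /= Hv; rewrite /h /= (y0E v a).
rewrite esum_triple; last by move=> m; rewrite lee_fin.
apply: le_esum => b _; apply: le_esum => c _; rewrite /h /=.
rewrite (eq_esum (b := fun a => (g (b, c))%:E * (p2 (y0 (b, c)) (a, b))%:E)%E); last first.
  by move=> a _; rewrite -EFinM mulrC.
by rewrite esumZl // ?p2_sum -?EFinM 1?mulrC // => a; rewrite lee_fin.
Qed.

Hypothesis p31_law : forall x y c, (law (EFin \o Q x y) snd c = (p31 c)%:E)%E.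
Hypothesis p2_ge : forall x y m, Q x y m <= p2 y m.1.
Hypothesis p23_sum : (\esum_(b in [set: W2]) (p23 b)%:E = 1)%E.

(** The ratio [t] below has mean at most 1 by [support_sum] with [g := p31], the factor [3 ^+ n]
    cancelling the weight of a triple. Since [Q <= p2], it is at least [3 ^+ n * p31], so taking
    logarithms compares [- ln p31] with [n * ln 3] on average. *)
Lemma link_entropy_ge :
  ((n%:R * ln 3)%:E <= \esum_(c in [set: W3]) (p31 c * - ln (p31 c))%:E)%E.
Proof.
have p31_sum : (\esum_(c in [set: W3]) (p31 c)%:E = 1)%E.
  have Q0 o : (0 <= (EFin \o Q [ffun=> false] [ffun=> false]) o)%E by rewrite lee_fin.
  rewrite -(Q_total [ffun=> false] [ffun=> false]) -(esum_law snd Q0).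
  by apply: eq_esum => c _; rewrite p31_law.
have p31_ge0 c : 0 <= p31 c.
  rewrite -lee_fin -(p31_law [ffun=> false] [ffun=> false]).
  by apply: law_ge0 => o; rewrite lee_fin.
have p31_le1 c : p31 c <= 1.
  by rewrite -lee_fin -p31_sum; apply: (@le_esum_term _ _ (EFin \o p31)).
have p23_ge0 b : 0 <= p23 b.
  by rewrite -lee_fin -(p2_sum [ffun=> false]); apply: esum_ge0 => a _; rewrite lee_fin.
have lnp c : 0 <= - ln (p31 c) by rewrite oppr_ge0 ln_le0.
pose t (o : V * (W1 * W2 * W3)) := 3 ^+ n * p31 o.2.2 * p2 (yin o.1) o.2.1 / Qv o.1 o.2.
have := @gibbs R _ triple_joint (fun o => - ln (p31 o.2.2)) (fun=> 0) t (n%:R * ln 3) 1.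
have -> : (\esum_(o in [set: V * (W1 * W2 * W3)]) (triple_joint o * - ln (p31 o.2.2))%:E
   = \esum_(c in [set: W3]) (p31 c * - ln (p31 c))%:E)%E.
  apply: (esum_mix_cst triple_weight_ge0 triple_weight_sum _
            (F := fun _ m => - ln (p31 m.2))) => //.
    by apply: esum_ge0 => c _; rewrite lee_fin mulr_ge0.
  move=> v _; rewrite -(eq_esum (a := fun c => law (EFin \o Qv v) snd c * (- ln (p31 c))%:E)%E).
    rewrite -(law_sum (f := EFin \o Qv v) snd (g := fun c => - ln (p31 c))) //.
    by move=> m; rewrite lee_fin.
  by move=> c _; rewrite p31_law.
have -> : (\esum_(o in [set: V * (W1 * W2 * W3)]) (triple_joint o * 0)%:E = 0)%E.
  by apply: esum1 => o _; rewrite mulr0.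
rewrite add0e; apply => //.
- by apply: mix_ge0 => //; exact: triple_weight_ge0.
- by apply: mix_total => //; [exact: triple_weight_ge0|exact: triple_weight_sum].
- by move=> o; rewrite /t !mulr_ge0 ?exprn_ge0 // invr_ge0.
- by rewrite mulr_ge0 // ln_ge0 // ler1n.
- have := support_sum (g := fun w => p31 w.2) (fun w => p31_ge0 w.2).
  rewrite [X in (_ <= X)%E](_ : _ = 1%E); last first.
    rewrite -p23_sum; apply: eq_esum => b _.
    rewrite -[RHS]mule1 -p31_sum -esumZl //.
  apply: le_trans; apply: le_esum => o _; rewrite lee_fin /triple_joint /mix /triple_weight /t.
  case: ifPn => [/eqP ->|Q1]; first by rewrite !(mul0r, mulr0).
  rewrite le_eqVlt; apply/orP; left; apply/eqP.
  field; rewrite Q1 /=; exact: expf_neq0.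
- move=> o /mix_gt0 Qo'; have {Qo'} Qo : 0 < Qv o.1 o.2 by exact: Qo'.
  have p2o : 0 < p2 (yin o.1) o.2.1 by apply: lt_le_trans Qo (p2_ge _ _ _).
  have p31o : 0 < p31 o.2.2.
    apply: lt_le_trans Qo _; rewrite -lee_fin -(p31_law (xin o.1) (yin o.1)).
    by apply: (law_term (f := EFin \o Qv o.1)) => m; rewrite lee_fin.
  have e3 : 0 < 3 ^+ n :> R by rewrite exprn_gt0.
  have to : 0 < t o by rewrite divr_gt0 // !mulr_gt0.
  have := ln_le_subr1 to.
  rewrite ln_div ?posrE ?mulr_gt0 // !lnM ?posrE ?mulr_gt0 // lnXn // mulr_natl.
  have : ln (Qv o.1 o.2) <= ln (p2 (yin o.1) o.2.1) by rewrite ler_ln ?posrE.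
  lra.
Qed.

End support.

(** * Entropy of the Alice-Bob link *)

Section middle_link.
Context {R : realType} {n : nat} {W1 W2 W3 : choiceType}.
Variables (Q : bits n -> bits n -> W1 * W2 * W3 -> R).
Variables (p12 : W1 -> R) (p23 : W2 -> R) (p31 : W3 -> R).
Variables (p1 : bits n -> W1 * W3 -> R) (p2 : bits n -> W1 * W2 -> R).
Variable (p3 : bits n -> W2 * W3 -> R).
Hypothesis Q_ge0 : forall x y m, 0 <= Q x y m.
Hypothesis Q_total : forall x y, (\esum_(m in [set: W1 * W2 * W3]) (Q x y m)%:E = 1)%E.
Hypothesis determines_x : forall x y x' y' a b b' c,
  Q x y (a, b, c) != 0 -> Q x' y' (a, b', c) != 0 -> x = x'.
Hypothesis determines_y : forall x y x' y' a b c c',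
  Q x y (a, b, c) != 0 -> Q x' y' (a, b, c') != 0 -> y = y'.
Hypothesis determines_z : forall x y x' y' a a' b c,
  Q x y (a, b, c) != 0 -> Q x' y' (a', b, c) != 0 -> AND x y = AND x' y'.
Hypothesis law_p12 : forall x y a, law (EFin \o Q x y) (fun m => m.1.1) a = (p12 a)%:E.
Hypothesis law_p23 : forall x y b, law (EFin \o Q x y) (fun m => m.1.2) b = (p23 b)%:E.
Hypothesis law_p31 : forall x y c, law (EFin \o Q x y) snd c = (p31 c)%:E.
Hypothesis law_p1 : forall x y w,
  law (EFin \o Q x y) (fun m => (m.1.1, m.2)) w = (p1 x w)%:E.
Hypothesis law_p2 : forall x y w, law (EFin \o Q x y) fst w = (p2 y w)%:E.
Hypothesis law_p3 : forall x y w,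
  law (EFin \o Q x y) (fun m => (m.1.2, m.2)) w = (p3 (AND x y) w)%:E.

Local Notation EQ x y := (EFin \o Q x y).

Let EQ_ge0 x y m : (0 <= EQ x y m)%E. Proof. by rewrite lee_fin. Qed.

Let z0 : bits n := [ffun=> false].

Lemma marginal_ge0 (V : choiceType) x y (U : W1 * W2 * W3 -> V) (p : V -> R) :
  (forall v, law (EQ x y) U v = (p v)%:E) -> forall v, 0 <= p v.
Proof. by move=> H v; rewrite -lee_fin -H law_ge0. Qed.

Lemma marginal_ge (V : choiceType) x y (U : W1 * W2 * W3 -> V) (p : V -> R) :
  (forall v, law (EQ x y) U v = (p v)%:E) -> forall m, Q x y m <= p (U m).
Proof. by move=> H m; rewrite -lee_fin -H (law_term (f := EQ x y)). Qed.

Lemma marginal_sum (V : choiceType) x y (U : W1 * W2 * W3 -> V) (p : V -> R) :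
  (forall v, law (EQ x y) U v = (p v)%:E) -> (\esum_(v in [set: V]) (p v)%:E = 1)%E.
Proof.
move=> H; rewrite -(Q_total x y) -(esum_law U (EQ_ge0 x y)).
by apply: eq_esum => v _; rewrite H.
Qed.

Lemma marginal_fst_sum (V T : choiceType) x y (U : W1 * W2 * W3 -> V * T) (p : V * T -> R) :
  (forall v, law (EQ x y) U v = (p v)%:E) ->
  forall t, (\esum_(v in [set: V]) (p (v, t))%:E = law (EQ x y) (snd \o U) t)%E.
Proof.
move=> H t; rewrite -law_comp // law_snd; last first.
  by move=> v; exact: law_ge0.
by apply: eq_esum => v _; rewrite H.
Qed.

Let p12_ge0 := marginal_ge0 (law_p12 z0 z0).
Let p23_ge0 := marginal_ge0 (law_p23 z0 z0).
Let p31_ge0 := marginal_ge0 (law_p31 z0 z0).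
Let p1_ge0 x := marginal_ge0 (law_p1 x z0).
Let p2_ge0 y := marginal_ge0 (law_p2 z0 y).
Let ANDxx (x : bits n) : AND x x = x.
Proof. by apply/ffunP => i; rewrite !ffunE andbb. Qed.
Let p3_law z w : law (EQ z z) (fun m => (m.1.2, m.2)) w = (p3 z w)%:E.
Proof. by rewrite law_p3 ANDxx. Qed.
Let p3_ge0 z := marginal_ge0 (p3_law z).

Lemma p1_marginal x c : (\esum_(a in [set: W1]) (p1 x (a, c))%:E = (p31 c)%:E)%E.
Proof. by rewrite (marginal_fst_sum (law_p1 x z0)) -(law_p31 x z0). Qed.

Lemma p2_marginal y b : (\esum_(a in [set: W1]) (p2 y (a, b))%:E = (p23 b)%:E)%E.
Proof. by rewrite (marginal_fst_sum (law_p2 z0 y)) -(law_p23 z0 y). Qed.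

Lemma p1_le_p31 x w : p1 x w <= p31 w.2.
Proof.
case: w => a c; rewrite -lee_fin -(p1_marginal x c) /=.
by apply: (@le_esum_term _ _ (fun a => (p1 x (a, c))%:E)) => i; rewrite lee_fin.
Qed.

(** As [p31] does not depend on the inputs, [p1 x (a, c) / p31 c] is the probability of [a] given
    [x] and [c]. The mean of [hiding] is thus H(M12 | M31, X) in nats; the value 0 off the support
    keeps it nonnegative. *)
Definition hiding (x : bits n) (w : W1 * W3) : R :=
  if p1 x w == 0 then 0 else ln (p31 w.2 / p1 x w).

Lemma hiding_ge0 x w : 0 <= hiding x w.
Proof.
rewrite /hiding; case: eqVneq => // p0; rewrite ln_ge0 //.
by rewrite ler_pdivlMr ?mul1r ?p1_le_p31 // lt_neqAle eq_sym p0 p1_ge0.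
Qed.

(* Charlie's view leaves every [y] that avoids [x] possible, and these are told
   apart by the Alice-Bob transcript: hence one bit per zero of [x]. *)
Lemma hiding_zeros x :
  (((zeros x)%:R * ln 2)%:E
   <= \esum_(w in [set: W1 * W3]) (p1 x w * hiding x w)%:E)%E.
Proof.
pose below := [pred y : bits n | [forall i, y i ==> ~~ x i]].
pose k := zeros x.
have e2 : 0 < 2 ^+ k :> R by rewrite exprn_gt0.
(* Uniform law on the [y] disjoint from [x]: all of them give the output [z0], hence the same law
   [p3 z0] of Charlie's transcripts. *)
pose wt (y : bits n) : R := if below y then 2 ^- k else 0.
have wt_ge0 y : 0 <= wt y by rewrite /wt; case: ifP => // _; rewrite invr_ge0 ltW.
have wt_sum : \sum_y wt y = 1.
  by rewrite /wt -big_mkcond sumr_const card_below -[LHS]mulr_natl natrX mulfV.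
have ANDbelow y : below y -> AND x y = z0.
  move=> /forallP H; apply/ffunP => i; rewrite !ffunE.
  by have := H i; case: (x i) (y i) => -[].
(* [p1 * p3 / p31] would be the joint law if M12 and M23 were independent given M31. Because
   [Q <= p3 z0] here, [t] is at least [2 ^+ k * p1 / p31], that is, [ln t >= k * ln 2 - hiding]. *)
pose t (o : bits n * (W1 * W2 * W3)) :=
  2 ^+ k * p1 x (o.2.1.1, o.2.2) * p3 z0 (o.2.1.2, o.2.2) / (p31 o.2.2 * Q x o.1 o.2).
have t_ge0 o : 0 <= t o.
  by rewrite divr_ge0 ?mulr_ge0 // ?(ltW e2).
have := @gibbs R _ (mix wt (Q x)) (fun o => hiding x (o.2.1.1, o.2.2)) (fun=> 0)
          t (k%:R * ln 2) 1.
rewrite (esum_mix_cst wt_ge0 wt_sum (fun y m => Q_ge0 x y m)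
   (F := fun _ m => hiding x (m.1.1, m.2))
   (K := (\esum_(w in [set: W1 * W3]) (p1 x w * hiding x w)%:E)%E)); last 3 first.
- by move=> _ m; exact: hiding_ge0.
- by apply: esum_ge0 => w _; rewrite lee_fin mulr_ge0 ?hiding_ge0 // p1_ge0.
- move=> y _.
  rewrite (law_sum (f := EQ x y) (fun m => (m.1.1, m.2)) (g := hiding x)) //.
    by apply: eq_esum => w _; rewrite law_p1.
  exact: hiding_ge0.
have -> : (\esum_(o in [set: bits n * (W1 * W2 * W3)]) (mix wt (Q x) o * 0)%:E = 0)%E.
  by apply: esum1 => o _; rewrite mulr0.
rewrite add0e; apply => //.
- exact: mix_ge0.
- by apply: mix_total.
- by move=> o; exact: hiding_ge0.
- by rewrite mulr_ge0 // ln_ge0 // ler1n.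
(* On the support [y] is a function of [(a, b)], so every transcript triple occurs for one [y] only;
   the mean of [t] is then at most the total mass of [h], which is at most 1. *)
- pose h (m : W1 * W2 * W3) : R := p1 x (m.1.1, m.2) * (p3 z0 (m.1.2, m.2) / p31 m.2).
  have h0 m : 0 <= h m by rewrite mulr_ge0 ?divr_ge0.
  apply: (@le_trans _ _ (\esum_(m in [set: W1 * W2 * W3]) (h m)%:E)%E).
    pose S := [set o : bits n * (W1 * W2 * W3) | mix wt (Q x) o != 0].
    rewrite (eq_esum (b := fun o => if o \in S then (mix wt (Q x) o * t o)%:E else 0%E)).
      rewrite -esum_mkcond; apply: (@esum_inj_le _ _ _ _ snd).
      + move=> [y [[a b] c]] [y' [[a' b'] c']].
        rewrite !inE /S /= /mix /= !mulf_eq0 !negb_or => /andP[_ Qy] /andP[_ Qy'].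
        by move=> [? ? ?]; subst; congr (_, _); exact: determines_y Qy Qy'.
      + by move=> m; rewrite lee_fin.
      + move=> o; rewrite /S /= /mix mulf_eq0 negb_or => /andP[wo Qo].
        have p31o : p31 o.2.2 != 0.
          apply: lt0r_neq0; apply: lt_le_trans (marginal_ge (law_p31 x o.1) o.2).
          by rewrite lt_neqAle eq_sym Qo Q_ge0.
        rewrite lee_fin /t /h; move: wo; rewrite /wt.
        case: ifP => [_ _|_]; last by rewrite eqxx.
        rewrite le_eqVlt; apply/orP; left; apply/eqP; field.
        by rewrite Qo p31o lt0r_neq0.
    move=> o _; case: ifPn => // /negP; rewrite inE /S /= => /negP.
    by rewrite negbK => /eqP ->; rewrite mul0r.
  rewrite esum_triple; last by move=> m; rewrite lee_fin.
  rewrite -(marginal_sum (p3_law z0)) esum_pair; last by move=> w; rewrite lee_fin p3_ge0.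
  apply: le_esum => b _; apply: le_esum => c _; rewrite /h /=.
  rewrite (eq_esum (b := fun a => (p3 z0 (b, c) / p31 c)%:E * (p1 x (a, c))%:E)%E); last first.
    by move=> a _; rewrite -EFinM mulrC.
  rewrite esumZl ?p1_marginal //; last 2 first.
  + by rewrite divr_ge0 // p3_ge0.
  + by move=> a; rewrite lee_fin p1_ge0.
  rewrite -EFinM lee_fin; have [->|pc] := eqVneq (p31 c) 0.
    by rewrite mulr0 p3_ge0.
  by rewrite divfK.
- move=> o mo; have Qo : 0 < Q x o.1 o.2 by exact: mix_gt0 mo.
  have bo : below o.1.
    by move: mo; rewrite /mix /wt; case: ifP => //; rewrite mul0r ltxx.
  have p31o : 0 < p31 o.2.2 by apply: lt_le_trans (marginal_ge (law_p31 x o.1) o.2).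
  have p1o : 0 < p1 x (o.2.1.1, o.2.2) by apply: lt_le_trans (marginal_ge (law_p1 x o.1) o.2).
  have Qp3 : Q x o.1 o.2 <= p3 z0 (o.2.1.2, o.2.2).
    by rewrite -(ANDbelow _ bo); exact: (marginal_ge (law_p3 x o.1) o.2).
  have p3o : 0 < p3 z0 (o.2.1.2, o.2.2) by apply: lt_le_trans Qp3.
  rewrite add0r /hiding (negbTE (lt0r_neq0 p1o)) /=.
  have to : 0 < t o by rewrite divr_gt0 // !mulr_gt0.
  have := ln_le_subr1 to.
  rewrite !(ln_div, lnM) ?posrE ?divr_gt0 ?mulr_gt0 // lnXn // mulr_natl.
  have : ln (Q x o.1 o.2) <= ln (p3 z0 (o.2.1.2, o.2.2)) by rewrite ler_ln ?posrE.
  lra.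
Qed.

Variables (al : bits n -> W1 * W3 -> R) (be : bits n -> W1 * W2 -> R) (ga : W2 * W3 -> R).
Variables (f12 g12 : W1 -> R) (f23 g23 : W2 -> R) (f31 g31 : W3 -> R).
Hypothesis al_ge0 : forall x w, 0 <= al x w.
Hypothesis be_ge0 : forall y w, 0 <= be y w.
Hypothesis ga_ge0 : forall w, 0 <= ga w.
Hypothesis Q_factor : forall x y m,
  Q x y m = al x (m.1.1, m.2) * be y m.1 * ga (m.1.2, m.2).
Hypotheses (f12_ge0 : forall a, 0 <= f12 a) (g12_ge0 : forall a, 0 <= g12 a).
Hypotheses (f23_ge0 : forall b, 0 <= f23 b) (g23_ge0 : forall b, 0 <= g23 b).
Hypotheses (f31_ge0 : forall c, 0 <= f31 c) (g31_ge0 : forall c, 0 <= g31 c).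
Hypotheses (split12 : forall a, p12 a <= f12 a * g12 a).
Hypotheses (split23 : forall b, p23 b <= f23 b * g23 b).
Hypotheses (split31 : forall c, p31 c <= f31 c * g31 c).
Hypothesis alice_le1 : forall x,
  (\esum_(w in [set: W1 * W3]) (al x w * g12 w.1 * f31 w.2)%:E <= 1)%E.
Hypothesis bob_le1 : forall y,
  (\esum_(w in [set: W1 * W2]) (be y w * f12 w.1 * g23 w.2)%:E <= 1)%E.
Hypothesis charlie_le1 :
  (\esum_(w in [set: W2 * W3]) (ga w * f23 w.1 * g31 w.2)%:E <= 1)%E.

Local Notation V := {ffun 'I_n -> 'I_3}.

(** The four ratios below multiply to at least [3 ^+ n * p12 * p31 / p1]: the party factors
    recombine to [Q], and each [f * g] is at least the law of its link. In logarithms this reads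
    I(M12; M31 | X) >= n ln 3, and [- ln p12] is that information density plus [hiding]. *)
Lemma middle_entropy_ge :
  ((n%:R * (ln 3 + ln 2 / 3))%:E <= \esum_(a in [set: W1]) (p12 a * - ln (p12 a))%:E)%E.
Proof.
pose wt : V -> R := @triple_weight R n.
have wt_ge0 : forall v, 0 <= wt v := @triple_weight_ge0 R n.
have wt_sum : \sum_v wt v = 1 := @triple_weight_sum R n.
pose Qv v := Q (xin v) (yin v).
have Qv_ge0 v m : 0 <= Qv v m by exact: Q_ge0.
(* Charlie's law averaged over the triples. With [p3 (yin v)] instead, the index would become a
   function of [(b, c)] in the bound on [t4], and the total mass could exceed 1. *)
pose pm (w : W2 * W3) : R := \sum_v wt v * p3 (yin v) w.
have pm_ge0 w : 0 <= pm w by apply: sumr_ge0 => v _; rewrite mulr_ge0.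
have pm_law w : law (EFin \o mix wt Qv) ((fun m => (m.1.2, m.2)) \o snd) w = (pm w)%:E.
  rewrite law_mix // -sumEFin; apply: eq_bigr => v _.
  by rewrite law_p3 AND_xin_yin EFinM.
have pm_sum : (\esum_(w in [set: W2 * W3]) (pm w)%:E = 1)%E.
  have M0 o : (0 <= (EFin \o mix wt Qv) o)%E by rewrite lee_fin mix_ge0.
  have /esum_law := M0 => /(_ _ ((fun m : W1 * W2 * W3 => (m.1.2, m.2)) \o snd)).
  rewrite (eq_esum (fun w _ => pm_law w)) => ->.
  by apply: mix_total => // v _; exact: Q_total.
have p12_le1 a : p12 a <= 1.
  rewrite -lee_fin -(marginal_sum (law_p12 z0 z0)).
  by apply: (@le_esum_term _ _ (EFin \o p12)) => i; rewrite lee_fin.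
have lnp12 a : 0 <= - ln (p12 a) by rewrite oppr_ge0 ln_le0.
(* [t1], [t2] and [t3] are the densities of the three replaced interactions with respect to the true
   laws of the transcripts of Alice, Bob and Charlie. *)
pose t1 (o : V * (W1 * W2 * W3)) :=
  al (xin o.1) (o.2.1.1, o.2.2) * g12 o.2.1.1 * f31 o.2.2 / p1 (xin o.1) (o.2.1.1, o.2.2).
pose t2 (o : V * (W1 * W2 * W3)) :=
  be (yin o.1) o.2.1 * f12 o.2.1.1 * g23 o.2.1.2 / p2 (yin o.1) o.2.1.
pose t3 (o : V * (W1 * W2 * W3)) :=
  ga (o.2.1.2, o.2.2) * f23 o.2.1.2 * g31 o.2.2 / pm (o.2.1.2, o.2.2).
(* [p2 * pm / p23] glues Bob's and Charlie's laws along M23; [3 ^+ n] undoes the weight of a triple,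
   and [support_sum] bounds the mean by the mass of [pm]. *)
pose t4 (o : V * (W1 * W2 * W3)) :=
  3 ^+ n * p2 (yin o.1) o.2.1 * pm (o.2.1.2, o.2.2) / (Qv o.1 o.2 * p23 o.2.1.2).
have t1_ge0 o : 0 <= t1 o by rewrite divr_ge0 // !mulr_ge0.
have t2_ge0 o : 0 <= t2 o by rewrite divr_ge0 // !mulr_ge0.
have t3_ge0 o : 0 <= t3 o by rewrite divr_ge0 // !mulr_ge0.
have t4_ge0 o : 0 <= t4 o by rewrite divr_ge0 ?mulr_ge0 ?exprn_ge0.
have t1_le : (\esum_(o in [set: V * (W1 * W2 * W3)]) (mix wt Qv o * t1 o)%:E <= 1)%E.
  apply: (esum_mix_le wt_ge0 wt_sum Qv_ge0 (F := fun v m => t1 (v, m))) => // v.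
  apply: le_trans (alice_le1 (xin v)).
  apply: (@density_le _ _ _ (EFin \o Qv v) (fun m => (m.1.1, m.2)) (p1 (xin v))
    (fun w => al (xin v) w * g12 w.1 * f31 w.2)).
  - by move=> m; exact: EQ_ge0.
  - by move=> w; rewrite !mulr_ge0.
  - exact: p1_ge0.
  - by move=> w; exact: law_p1.
have t2_le : (\esum_(o in [set: V * (W1 * W2 * W3)]) (mix wt Qv o * t2 o)%:E <= 1)%E.
  apply: (esum_mix_le wt_ge0 wt_sum Qv_ge0 (F := fun v m => t2 (v, m))) => // v.
  apply: le_trans (bob_le1 (yin v)).
  apply: (@density_le _ _ _ (EFin \o Qv v) fst (p2 (yin v))
    (fun w => be (yin v) w * f12 w.1 * g23 w.2)).
  - by move=> m; exact: EQ_ge0.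
  - by move=> w; rewrite !mulr_ge0.
  - exact: p2_ge0.
  - by move=> w; exact: law_p2.
have t3_le : (\esum_(o in [set: V * (W1 * W2 * W3)]) (mix wt Qv o * t3 o)%:E <= 1)%E.
  apply: le_trans charlie_le1.
  apply: (@density_le _ _ _ (EFin \o mix wt Qv) ((fun m => (m.1.2, m.2)) \o snd) pm
    (fun w => ga w * f23 w.1 * g31 w.2)) => //.
  + by move=> o; rewrite lee_fin mix_ge0.
  + by move=> w; rewrite !mulr_ge0.
have t4_le : (\esum_(o in [set: V * (W1 * W2 * W3)]) (mix wt Qv o * t4 o)%:E <= 1)%E.
  apply: le_trans (_ : (\esum_(b in [set: W2]) \esum_(c in [set: W3])
    (p23 b * (pm (b, c) / p23 b))%:E <= 1)%E); last first.
    rewrite -pm_sum esum_pair; last by move=> w; rewrite lee_fin.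
    apply: le_esum => b _; apply: le_esum => c _; rewrite lee_fin.
    have [->|pb] := eqVneq (p23 b) 0; first by rewrite mul0r.
    by rewrite mulrC divfK.
  apply: le_trans (support_sum determines_x determines_z p2_ge0 p2_marginal
     (g := fun w => pm w / p23 w.1) _); last by move=> w; rewrite divr_ge0.
  apply: le_esum => o _; rewrite lee_fin /t4 /mix /wt /triple_weight /Qv /=.
  case: ifPn => [/eqP ->|Qo]; first by rewrite !(mulr0, mul0r).
  have p23o : p23 o.2.1.2 != 0.
    apply: lt0r_neq0; apply: lt_le_trans (marginal_ge (law_p23 (xin o.1) (yin o.1)) o.2).
    by rewrite lt_neqAle eq_sym Qo Q_ge0.
  rewrite le_eqVlt; apply/orP; left; apply/eqP; field.
  by rewrite Qo p23o expf_neq0.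
(* A single application for all four ratios, whence the 4. Taking [hiding] as the function [G]
   avoids any subtraction of possibly infinite entropies. *)
have := @gibbs R _ (mix wt Qv) (fun o => - ln (p12 o.2.1.1))
   (fun o => hiding (xin o.1) (o.2.1.1, o.2.2))
   (fun o => t1 o + t2 o + t3 o + t4 o) (n%:R * ln 3) 4.
rewrite (esum_mix_cst wt_ge0 wt_sum Qv_ge0 (F := fun _ m => - ln (p12 m.1.1))
   (K := (\esum_(a in [set: W1]) (p12 a * - ln (p12 a))%:E)%E)); last 3 first.
- by move=> _ m; exact: lnp12.
- by apply: esum_ge0 => a _; rewrite lee_fin mulr_ge0.
- move=> v _; rewrite (law_sum (fun m => m.1.1) (EQ_ge0 _ _) lnp12).
  by apply: eq_esum => w _; rewrite law_p12.
rewrite (esum_mix wt_ge0 Qv_ge0 (F := fun v m => hiding (xin v) (m.1.1, m.2))); last first.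
  by move=> v m; exact: hiding_ge0.
move=> H; apply: le_trans (H _ _ _ _ _ _ _ _ _) => {H} //.
- rewrite mulrDr addrC EFinD leeD2r //.
  apply: (@le_trans _ _ (\sum_v (wt v)%:E * ((zeros (xin v))%:R * ln 2)%:E)%E).
    under eq_bigr do rewrite -EFinM mulrA.
    rewrite sumEFin -mulr_suml lee_fin.
    have : (\sum_(v : V) zeros (xin v))%:R * 3 = n%:R * 3 ^+ n :> R.
      by rewrite -natrX -!natrM -sum_zeros -big_distrl.
    rewrite /wt /triple_weight -mulr_sumr -natr_sum => /(canRL (mulfK _)) -> //.
    rewrite le_eqVlt; apply/orP; left; apply/eqP; field; exact: expf_neq0.
  apply: lee_sum => v _; rewrite lee_wpmul2l ?lee_fin //.
  apply: le_trans (hiding_zeros _) _.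
  rewrite -(eq_esum (a := fun w => law (EQ (xin v) (yin v)) (fun m => (m.1.1, m.2)) w
     * (hiding (xin v) w)%:E)%E); last by move=> w _; rewrite law_p1.
  rewrite -(law_sum (f := EQ (xin v) (yin v)) (fun m => (m.1.1, m.2))
     (g := hiding (xin v))) //.
  exact: hiding_ge0.
- exact: mix_ge0.
- by apply: mix_total => // v _; exact: Q_total.
- by move=> o; exact: hiding_ge0.
- by move=> o; rewrite !addr_ge0.
- by rewrite mulr_ge0 // ln_ge0 // ler1n.
- have mx o : 0 <= mix wt Qv o by exact: mix_ge0.
  rewrite (_ : 4%:E = 1 + 1 + 1 + 1)%E; last by rewrite -!EFinD; congr EFin; ring.
  under eq_esum do rewrite !mulrDr !EFinD.
  rewrite !esumD; try by move=> o _; do ?[apply: adde_ge0]; rewrite lee_fin mulr_ge0.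
  by rewrite !leeD.
- move=> o mo; have Qo : 0 < Q (xin o.1) (yin o.1) o.2 := mix_gt0 Qv_ge0 mo.
  have p1o : 0 < p1 (xin o.1) (o.2.1.1, o.2.2).
    by apply: lt_le_trans (marginal_ge (law_p1 (xin o.1) (yin o.1)) o.2).
  have p2o : 0 < p2 (yin o.1) o.2.1.
    by apply: lt_le_trans (marginal_ge (law_p2 (xin o.1) (yin o.1)) o.2).
  have p12o : 0 < p12 o.2.1.1.
    by apply: lt_le_trans (marginal_ge (law_p12 (xin o.1) (yin o.1)) o.2).
  have p23o : 0 < p23 o.2.1.2.
    by apply: lt_le_trans (marginal_ge (law_p23 (xin o.1) (yin o.1)) o.2).
  have p31o : 0 < p31 o.2.2.
    by apply: lt_le_trans (marginal_ge (law_p31 (xin o.1) (yin o.1)) o.2).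
  have pmo : 0 < pm (o.2.1.2, o.2.2).
    apply: lt_le_trans mo _; rewrite -lee_fin -pm_law.
    by apply: (law_term (f := EFin \o mix wt Qv)) => i; rewrite lee_fin mix_ge0.
  (* Logarithms of products can be split only into positive factors; positivity of all of them is
     deduced from that of [Q] and of the link laws. *)
  have pos (u v : R) : 0 <= u -> 0 <= v -> 0 < u * v -> (0 < u) /\ (0 < v).
    by move=> u0 v0 uv; split; rewrite lt_neqAle ?u0 ?v0 andbT eq_sym;
      apply: contraTneq uv => ->; rewrite ?mul0r ?mulr0 ltxx.
  have [f12o g12o] := pos _ _ (f12_ge0 _) (g12_ge0 _) (lt_le_trans p12o (split12 _)).
  have [f23o g23o] := pos _ _ (f23_ge0 _) (g23_ge0 _) (lt_le_trans p23o (split23 _)).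
  have [f31o g31o] := pos _ _ (f31_ge0 _) (g31_ge0 _) (lt_le_trans p31o (split31 _)).
  have := Qo; rewrite Q_factor => /(pos _ _ (mulr_ge0 (al_ge0 _ _) (be_ge0 _ _)) (ga_ge0 _)).
  move=> [/(pos _ _ (al_ge0 _ _) (be_ge0 _ _))[alo beo] gao].
  have e3 : 0 < 3 ^+ n :> R by rewrite exprn_gt0.
  have t1o : 0 < t1 o by rewrite divr_gt0 // !mulr_gt0.
  have t2o : 0 < t2 o by rewrite divr_gt0 // !mulr_gt0.
  have t3o : 0 < t3 o by rewrite divr_gt0 // !mulr_gt0.
  have t4o : 0 < t4 o by rewrite divr_gt0 // !mulr_gt0.
  rewrite /hiding (negbTE (lt0r_neq0 p1o)) /=.
  (* In the sum of the four inequalities [ln t <= t - 1], the logarithms of [al], [be], [ga] cancel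
     against [ln Q], those of [f] and [g] are bounded below by the splits, and [p2], [pm], [p23]
     cancel. *)
  have := ln_le_subr1 t1o; have := ln_le_subr1 t2o.
  have := ln_le_subr1 t3o; have := ln_le_subr1 t4o.
  have := split12 o.2.1.1; rewrite -ler_ln ?posrE ?mulr_gt0 // lnM ?posrE //.
  have := split23 o.2.1.2; rewrite -ler_ln ?posrE ?mulr_gt0 // lnM ?posrE //.
  have := split31 o.2.2; rewrite -ler_ln ?posrE ?mulr_gt0 // lnM ?posrE //.
  have lnQ : ln (Qv o.1 o.2) = ln (al (xin o.1) (o.2.1.1, o.2.2))
     + ln (be (yin o.1) o.2.1) + ln (ga (o.2.1.2, o.2.2)).
    by rewrite /Qv Q_factor !lnM ?posrE ?mulr_gt0.
  rewrite !(ln_div, lnM) ?posrE ?divr_gt0 ?mulr_gt0 // lnXn // lnQ mulr_natl.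
  lra.
Qed.

End middle_link.

(** * Unique decoding of a link *)

Local Notation ent h t := (nth ([::], [::]) h t).

Lemma prefix_free_cat (c : word -> bool) u v s s' :
  prefix_free c -> c u -> c v -> u ++ s = v ++ s' -> u = v.
Proof.
move=> pf cu cv e.
have [uv|/ltnW vu] := leqP (size u) (size v).
  by apply: pf => //; rewrite prefixE -(takel_cat s' uv) -e take_size_cat.
by apply/esym/pf => //; rewrite prefixE -(takel_cat s vu) e take_size_cat.
Qed.

Lemma transcript_cat h h' : transcript (h ++ h') = transcript h ++ transcript h'.
Proof. by rewrite /transcript map_cat flatten_cat. Qed.

Lemma transcript_rcons h p : transcript (rcons h p) = transcript h ++ (p.1 ++ p.2).
Proof. by rewrite -cats1 transcript_cat /transcript /= cats0. Qed.

Section link.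
Variables (c1 c2 : hist -> word -> bool).
Hypotheses (pf1 : forall h, prefix_free (c1 h)) (pf2 : forall h, prefix_free (c2 h)).

Definition valid (h : hist) :=
  forall t, (t < size h)%N -> c1 (take t h) (ent h t).1 && c2 (take t h) (ent h t).2.

Lemma valid_take h t : valid h -> valid (take t h).
Proof.
move=> vh s; rewrite size_take_min leq_min => /andP[st sh].
by rewrite take_takel ?(ltnW st) // nth_take // vh.
Qed.

(** Induction on the last round: once the earlier rounds agree, both last rounds use the same
    prefix-free codes and are decoded one word at a time. The tails [s], [s'] absorb the rounds
    peeled off, and later allow different numbers of rounds to be compared. *)
Lemma valid_decode h h' s s' : valid h -> valid h' -> size h = size h' ->
  transcript h ++ s = transcript h' ++ s' -> h = h'.
Proof.
elim/last_ind: h h' s s' => [|h p IH] h' s s'.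
  by case: h' => // p h'.
elim/last_ind: h' => [|h' p' _]; first by rewrite size_rcons.
rewrite !size_rcons !transcript_rcons -!catA => vp vp' [sz] e.
have hh' : h = h'.
  apply: IH sz e.
    by have := valid_take (t := size h) vp; rewrite -cats1 take_size_cat.
  by have := valid_take (t := size h') vp'; rewrite -cats1 take_size_cat.
subst h'; congr rcons.
move/eqP: e; rewrite eqseq_cat // eqxx /= => /eqP e.
have := vp (size h); rewrite size_rcons nth_rcons ltnn eqxx => /(_ (leqnn _)).
rewrite -cats1 take_size_cat // => /andP[p1 p2].
have := vp' (size h); rewrite size_rcons nth_rcons ltnn eqxx => /(_ (leqnn _)).
rewrite -cats1 take_size_cat // => /andP[p1' p2'].
have e1 := prefix_free_cat (@pf1 h) p1 p1' e.
move: e; rewrite e1 => /eqP; rewrite eqseq_cat // eqxx /= => /eqP e.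
have e2 := prefix_free_cat (@pf2 h) p2 p2' e.
by rewrite [p]surjective_pairing [p']surjective_pairing e1 e2.
Qed.

(** The number of rounds has to be given: the empty word may be a codeword, and silent rounds leave
    no trace in the transcript. *)
Definition dec (m : word) (T : nat) : option hist :=
  match pselect (exists h, [/\ valid h, size h = T & transcript h = m]) with
  | left H => Some (projT1 (cid H))
  | right _ => None
  end.

Lemma decP m T h :
  dec m T = Some h <-> [/\ valid h, size h = T & transcript h = m].
Proof.
rewrite /dec; case: pselect => [H|nH]; last by split => // H; case: nH; exists h.
case: (cid H) => h' /= [v' s' t']; split=> [[<-] //|[v s t]]; congr Some.
by apply: (valid_decode (s := [::]) (s' := [::])) => //; rewrite ?s ?t ?cats0.
Qed.

Lemma dec_take m T T' h h' :
  dec m T = Some h -> dec m T' = Some h' -> (T <= T')%N -> take T h' = h.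
Proof.
move=> /decP[v s t] /decP[v' s' t'] TT'.
apply: (valid_decode (s := transcript (drop T h')) (s' := [::])) => //.
- exact: valid_take.
- by rewrite size_takel ?s'.
- by rewrite -transcript_cat cat_take_drop cats0 t.
Qed.

(** If the same transcript arises after [T] and after [T'] rounds, the rounds in between carry no
    bits, by comparison of lengths. The round numbers at which [m] decodes thus form an interval. *)
Lemma dec_between m T T' S h h' :
  dec m T = Some h -> dec m T' = Some h' -> (T <= S <= T')%N ->
  dec m S = Some (take S h').
Proof.
move=> dT dT' /andP[TS ST']; have hh' := dec_take dT dT' (leq_trans TS ST').
move: (dT) (dT') => /decP[v s t] /decP[v' s' t']; apply/decP; split.
- exact: valid_take.
- by rewrite size_takel ?s'.
- have e1 : transcript (take S h') = m ++ transcript (drop T (take S h')).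
    rewrite -[in LHS](cat_take_drop T (take S h')) transcript_cat take_takel //.
    by rewrite hh' t.
  have : size (m ++ (transcript (drop T (take S h')) ++ transcript (drop S h'))) = size m.
    by rewrite catA -e1 -transcript_cat cat_take_drop t'.
  rewrite e1 !size_cat => /eqP; rewrite -[X in _ == X]addn0 eqn_add2l addn_eq0.
  by move=> /andP[/eqP/size0nil -> _]; rewrite cats0.
Qed.

End link.

(** * Probability weights of decoded transcripts and their limits *)

Section weights.
Context {R : realType}.
Variables (c1 c2 d1 d2 : hist -> word -> bool).
Hypotheses (pf1 : forall h, prefix_free (c1 h)) (pf2 : forall h, prefix_free (c2 h)).
Hypotheses (qf1 : forall h, prefix_free (d1 h)) (qf2 : forall h, prefix_free (d2 h)).

(** A kernel sees two links at once: the history of each, then the message pair of the current round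
    on each. *)
Definition kernel := hist -> hist -> word * word -> word * word -> R.

Definition weight (k : kernel) (T : nat) (h h' : hist) : R :=
  \prod_(t < T) k (take t h) (take t h') (ent h t) (ent h' t).

Definition wdec (k : kernel) (m m' : word) (T : nat) : R :=
  match dec c1 c2 m T, dec d1 d2 m' T with
  | Some h, Some h' => weight k T h h'
  | _, _ => 0
  end.

Definition wlim (k : kernel) (m m' : word) : R := limn (wdec k m m').

Definition bounded (k : kernel) := forall h h' r r', 0 <= k h h' r r' <= 1.

Lemma weight_ge0 k T h h' : bounded k -> 0 <= weight k T h h'.
Proof.
move=> kb; apply: prodr_ge0 => t _.
by case/andP: (kb (take t h) (take t h') (ent h t) (ent h' t)).
Qed.

Lemma weightS k T h h' :
  weight k T.+1 h h' =
  weight k T (take T h) (take T h') * k (take T h) (take T h') (ent h T) (ent h' T).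
Proof.
rewrite /weight big_ord_recr /=; congr (_ * _); apply: eq_bigr => t _.
by rewrite !take_takel ?(ltnW (ltn_ord t)) // !nth_take.
Qed.

Lemma wdec_ge0 k m m' T : bounded k -> 0 <= wdec k m m' T.
Proof.
by move=> kb; rewrite /wdec; case: dec => // h; case: dec => // h'; exact: weight_ge0.
Qed.

Lemma wdec_step k m m' T S : bounded k -> (T <= S)%N ->
  dec c1 c2 m T -> dec d1 d2 m' T -> wdec k m m' S.+1 <= wdec k m m' S.
Proof.
move=> kb TS; case e: (dec c1 c2 m T) => [h|//] _; case e': (dec d1 d2 m' T) => [h'|//] _.
rewrite [X in X <= _]/wdec; case eS: (dec c1 c2 m S.+1) => [g|]; last exact: wdec_ge0.
case eS': (dec d1 d2 m' S.+1) => [g'|]; last exact: wdec_ge0.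
have TSS : (T <= S <= S.+1)%N by rewrite TS leqnSn.
rewrite /wdec (dec_between pf1 pf2 e eS TSS) (dec_between qf1 qf2 e' eS' TSS) weightS.
have /andP[k0 k1] := kb (take S g) (take S g') (ent g S) (ent g' S).
by rewrite ler_piMr // weight_ge0.
Qed.

(** The sequence is 0 until both words decode; from then on each further round multiplies it by a
    factor of at most 1, or makes it 0 when decoding stops. *)
Lemma wdec_cvg k m m' : bounded k -> cvgn (wdec k m m').
Proof.
move=> kb.
have [[T [hT hT']]|nT] := pselect (exists T, dec c1 c2 m T /\ dec d1 d2 m' T).
  have /cvg_ex[l] : cvgn (fun S => wdec k m m' (S + T)%N).
    apply: nonincreasing_is_cvgn.
      apply/nonincreasing_seqP => S; rewrite /= addSn.
      by apply: (wdec_step kb (T := T)) => //; rewrite leq_addl.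
    by exists 0 => _ [S _ <-]; exact: wdec_ge0.
  by rewrite (cvg_shiftn T) => wl; apply/cvg_ex; exists l.
rewrite (_ : wdec k m m' = cst 0); first exact: is_cvg_cst.
apply/funext => T; rewrite /wdec.
case e: dec => [h|//]; case e': dec => [h'|//].
by case: nT; exists T; rewrite e e'.
Qed.

Lemma wlim_ge0 k m m' : bounded k -> 0 <= wlim k m m'.
Proof.
move=> kb; apply: limr_ge; first exact: wdec_cvg.
by apply: nearW => T; exact: wdec_ge0.
Qed.

Lemma wlim_neq0 k m m' : bounded k -> wlim k m m' != 0 ->
  exists T, forall S, (T <= S)%N -> dec c1 c2 m S /\ dec d1 d2 m' S.
Proof.
move=> kb w0; have wp : 0 < wlim k m m' by rewrite lt_neqAle eq_sym w0 wlim_ge0.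
have : \forall T \near \oo, 0 < wdec k m m' T by apply: cvgr_gt wp; exact: wdec_cvg.
move=> [T _ HT]; exists T => S /HT /=; rewrite /wdec.
by case: (dec c1 c2 m S) => [h|]; case: (dec d1 d2 m' S) => [h'|]; rewrite ?ltxx.
Qed.

Lemma wlim_sum k (s : seq (word * word)) : bounded k ->
  (fun T => \sum_(w <- s) wdec k w.1 w.2 T) @ \oo --> \sum_(w <- s) wlim k w.1 w.2.
Proof.
move=> kb; elim: s => [|w s IH].
  rewrite big_nil (_ : (fun _ => _) = cst 0); first exact: cvg_cst.
  by apply/funext => T; rewrite big_nil.
rewrite big_cons (_ : (fun _ => _) = wdec k w.1 w.2 \+ (fun T => \sum_(w <- s) wdec k w.1 w.2 T)).
  by apply: cvgD => //; exact: wdec_cvg.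
by apply/funext => T; rewrite big_cons.
Qed.

Local Open Scope ereal_scope.

(** Induction on the number of rounds: splitting off the last round is injective, and that round has
    total weight at most 1 given the past. *)
Lemma weight_total (k : kernel) T : bounded k ->
  (forall h h', \esum_(r in [set: (word * word) * (word * word)])
     (k h h' r.1 r.2)%:E <= 1) ->
  \esum_(H in [set: hist * hist])
    (if (size H.1 == T) && (size H.2 == T) then weight k T H.1 H.2 else 0)%:E <= 1.
Proof.
move=> kb k1; elim: T => [|T IH].
  rewrite (esum_single (t := ([::], [::]))) /=; last 2 first.
  - by rewrite lee_fin /weight big_ord0.
  - move=> [h h'] /= hh; case: ifPn => // /andP[/eqP/size0nil h0 /eqP/size0nil h0'].
    by rewrite h0 h0' eqxx in hh.
  by rewrite /weight big_ord0.
apply: le_trans IH.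
pose e (H : hist * hist) := ((take T H.1, take T H.2), (ent H.1 T, ent H.2 T)).
pose F T (H : hist * hist) : R :=
  (if (size H.1 == T) && (size H.2 == T) then weight k T H.1 H.2 else 0)%R.
have F0 S H : (0 <= F S H)%R by rewrite /F; case: ifP => // _; exact: weight_ge0.
have k0 h h' r r' : (0 <= k h h' r r')%R by case/andP: (kb h h' r r').
pose G (o : (hist * hist) * ((word * word) * (word * word))) : R :=
  (F T o.1 * k o.1.1 o.1.2 o.2.1 o.2.2)%R.
have G0 o : (0 <= G o)%R by rewrite mulr_ge0.
apply: (@le_trans _ _
  (\esum_(o in [set: (hist * hist) * ((word * word) * (word * word))]) (G o)%:E)).
  pose S := [set H : hist * hist | size H.1 = T.+1 /\ size H.2 = T.+1].
  rewrite (eq_esum (b := fun H => if H \in S then (F T.+1 H)%:E else 0)); last first.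
    move=> H _; rewrite /F; case: ifPn => [/andP[/eqP ? /eqP ?]|].
      by rewrite mem_set.
    by move=> nH; rewrite memNset // => -[s1 s2]; move: nH; rewrite s1 s2 eqxx.
  rewrite -esum_mkcond; apply: (@esum_inj_le _ _ _ _ e).
  - move=> [h h'] [g g'] /set_mem [/= s1 s2] /set_mem [/= s3 s4] [e1 e2 e3 e4].
    rewrite -[h]take_size -[g]take_size -[h']take_size -[g']take_size s1 s2 s3 s4.
    rewrite !(take_nth ([::], [::])) ?s1 ?s2 ?s3 ?s4 //.
    by rewrite e1 e2; move: e3 e4; rewrite /e /= => -> ->.
  - by move=> o; rewrite lee_fin.
  - move=> [h h'] [/= s1 s2]; rewrite /G /F /e /= s1 s2 eqxx /= weightS.
    by rewrite !size_takel ?s1 ?s2 // eqxx.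
rewrite esum_pair; last by move=> o; rewrite lee_fin.
apply: le_esum => H _; rewrite -/(F T H).
rewrite (eq_esum (b := fun r => (F T H)%:E * (k H.1 H.2 r.1 r.2)%:E)); last first.
  by move=> r _; rewrite -EFinM.
rewrite esumZl //; last by move=> r; rewrite lee_fin.
rewrite -[X in _ <= X]mule1; apply: lee_wpmul2l; first by rewrite lee_fin.
exact: k1.
Qed.

(** A Fatou argument: finite sums commute with the limit, and at a fixed round distinct transcript
    pairs decode to distinct history pairs, which [weight_total] controls. *)
Lemma wlim_total (k : kernel) : bounded k ->
  (forall h h', \esum_(r in [set: (word * word) * (word * word)])
     (k h h' r.1 r.2)%:E <= 1) ->
  \esum_(w in [set: word * word]) (wlim k w.1 w.2)%:E <= 1.
Proof.
move=> kb k1; apply: esum_fset_le => [w|s us]; first by rewrite lee_fin wlim_ge0.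
rewrite sumEFin lee_fin.
have sl := @wlim_sum k s kb; rewrite -(cvg_lim _ sl) //.
apply: limr_le; first by apply/cvg_ex; eexists; exact: sl.
apply: nearW => T; rewrite -lee_fin -sumEFin.
have w0 (w : word * word) : (0 <= (wdec k w.1 w.2 T)%:E) by rewrite lee_fin wdec_ge0.
apply: le_trans (sum_le_esum w0 us) _.
apply: le_trans (weight_total T kb k1).
pose S := [set w : word * word | dec c1 c2 w.1 T /\ dec d1 d2 w.2 T].
rewrite (eq_esum (b := fun w => if w \in S then (wdec k w.1 w.2 T)%:E else 0)); last first.
  move=> w _; case: ifPn => // /negP; rewrite inE /S /wdec /=.
  by case: dec => // h; case: dec => // h' [].
rewrite -esum_mkcond.
apply: (@esum_inj_le _ _ _ _
  (fun w => (odflt [::] (dec c1 c2 w.1 T), odflt [::] (dec d1 d2 w.2 T)))).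
- move=> [m m'] [n n'] /set_mem [/=].
  case e1: (dec c1 c2 m T) => [h|//] _; case e2: (dec d1 d2 m' T) => [h'|//] _.
  move=> /set_mem [/=].
  case e3: (dec c1 c2 n T) => [g|//] _; case e4: (dec d1 d2 n' T) => [g'|//] _ [? ?].
  subst g g'; move: e1 e2 e3 e4 => /decP[] // _ _ <- /decP[] // _ _ <-.
  by move=> /decP[] // _ _ <- /decP[] // _ _ <-.
- by move=> H; rewrite lee_fin; case: ifP => // _; exact: weight_ge0.
- move=> [m m'] [/=]; rewrite /wdec /=.
  case e1: (dec c1 c2 m T) => [h|//] _; case e2: (dec d1 d2 m' T) => [h'|//] _ /=.
  by move: e1 e2 => /decP[] // _ -> _ /decP[] // _ -> _; rewrite eqxx.
Qed.

End weights.

(** * Splitting a link law into its two speakers *)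

Section link_weight.
Context {R : realType}.
Local Notation kernel := (hist -> hist -> word * word -> word * word -> R).

(** The one-link case of [wlim]: the link occupies both slots, and the kernel ignores the second
    copy. *)
Definition link_weight (c1 c2 : hist -> word -> bool) (k : hist -> word * word -> R)
    (m : word) : R :=
  wlim c1 c2 c1 c2 (fun h _ r _ => k h r) m m.

Lemma limn_mul (u v : R^nat) : cvgn u -> cvgn v ->
  (fun T => u T * v T) @ \oo --> limn u * limn v.
Proof. by move=> cu cv; exact: cvgM. Qed.

Lemma limn_mul3 (u v w : R^nat) : cvgn u -> cvgn v -> cvgn w ->
  (fun T => u T * v T * w T) @ \oo --> limn u * limn v * limn w.
Proof. by move=> cu cv cw; apply: cvgM => //; exact: cvgM. Qed.

Section split.
Variables (c1 c2 : hist -> word -> bool) (p : word -> R).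
Hypotheses (pf1 : forall h, prefix_free (c1 h)) (pf2 : forall h, prefix_free (c2 h)).
Hypotheses (p_ge0 : forall m, 0 <= p m).
Hypothesis p_sum : (\esum_(m in [set: word]) (p m)%:E <= 1)%E.

Definition extends (m : word) (h : hist) : Prop :=
  exists T g, [/\ dec c1 c2 m T = Some g, (size h <= T)%N & take (size h) g = h].

Lemma extends_uniq m h r r' :
  extends m (rcons h r) -> extends m (rcons h r') -> r = r'.
Proof.
move=> [T [g [dT sT tg]]] [T' [g' [dT' sT' tg']]].
suff : rcons h r = rcons h r' by move=> /rcons_inj[].
rewrite -tg -tg' !size_rcons. rewrite !size_rcons in sT sT'.
have [TT'|/ltnW TT'] := leqP T T'.
  by rewrite -(dec_take pf1 pf2 dT dT' TT') take_takel.
by rewrite -(dec_take pf1 pf2 dT' dT TT') take_takel.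
Qed.

Lemma extends_rcons m h r : extends m (rcons h r) -> extends m h.
Proof.
move=> [T [g [dT sT tg]]]; exists T, g; split=> //.
  by apply: leq_trans sT; rewrite size_rcons.
have := congr1 (take (size h)) tg.
by rewrite size_rcons take_takel // -cats1 take_size_cat.
Qed.

Definition mass (E : set word) : R := fine (\esum_(m in E) (p m)%:E)%E.

Lemma massE (E : set word) : (\esum_(m in E) (p m)%:E = (mass E)%:E)%E.
Proof.
rewrite /mass fineK // ge0_fin_numE; last by apply: esum_ge0 => m _; rewrite lee_fin.
apply: le_lt_trans (ltry 1); apply: le_trans p_sum.
by rewrite esum_mkcond; apply: le_esum => m _; case: ifP; rewrite ?lee_fin.
Qed.

Lemma mass_ge0 E : 0 <= mass E.
Proof. by rewrite -lee_fin -massE; apply: esum_ge0 => m _; rewrite lee_fin. Qed.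

Lemma mass_le1 E : mass E <= 1.
Proof.
rewrite -lee_fin -massE; apply: le_trans p_sum.
by rewrite esum_mkcond; apply: le_esum => m _; case: ifP; rewrite ?lee_fin.
Qed.

Lemma mass_ge (E : set word) m : E m -> p m <= mass E.
Proof.
move=> Em; rewrite -lee_fin -massE esum_mkcond.
apply: le_trans (le_esum_term m _); first by rewrite mem_set.
by move=> i; case: ifP; rewrite ?lee_fin.
Qed.

Lemma mass_family (I : choiceType) (E : I -> set word) (G : set word) :
  (forall i m, E i m -> G m) -> (forall i j m, E i m -> E j m -> i = j) ->
  (\esum_(i in [set: I]) (mass (E i))%:E <= (mass G)%:E)%E.
Proof.
move=> EG Einj.
under eq_esum do rewrite -massE.
rewrite esum_esum; last by move=> i j _ _; rewrite lee_fin.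
rewrite -massE [leRHS]esum_mkcond.
apply: (@esum_inj_le _ _ _ _ snd).
- move=> [i m] [j m'] /set_mem [/= _ Em] /set_mem [/= _ Em'] mm'; subst m'.
  by rewrite (Einj _ _ _ Em Em').
- by move=> m; case: ifP; rewrite ?lee_fin.
- by move=> [i m] [/= _ Em]; rewrite mem_set //; exact: EG Em.
Qed.

Lemma mass_family1 (I : choiceType) (E : I -> set word) (G : set word) i :
  (forall i m, E i m -> G m) -> (forall i j m, E i m -> E j m -> i = j) ->
  mass (E i) <= mass G.
Proof.
move=> EG Einj; rewrite -lee_fin; apply: le_trans (mass_family EG Einj).
by apply: (@le_esum_term _ _ (fun i => (mass (E i))%:E)) => j; rewrite lee_fin mass_ge0.
Qed.

(** Masses of the transcripts that pass through [h], and of those whose next first message is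
    moreover [a]. Their successive ratios are the causal conditional probabilities. *)
Let N h := mass [set m | extends m h].
Let N1 h a := mass [set m | exists b, extends m (rcons h (a, b))].

(* Junk value 0 when the conditioning event has mass 0. *)
Definition first_kernel (h : hist) (a : word) : R := N1 h a / N h.
Definition second_kernel (h : hist) (a b : word) : R := N (rcons h (a, b)) / N1 h a.

Let ratio_bounds (u v : R) : 0 <= u <= v -> 0 <= u / v <= 1.
Proof.
move=> /andP[u0 uv]; rewrite divr_ge0 ?(le_trans u0 uv) //=.
have [->|v0] := eqVneq v 0; first by rewrite invr0 mulr0 ler01.
by rewrite ler_pdivrMr ?mul1r // lt_neqAle eq_sym v0 (le_trans u0 uv).
Qed.

Let N1_family h : (forall a m, (exists b, extends m (rcons h (a, b))) -> extends m h) /\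
  (forall a a' m, (exists b, extends m (rcons h (a, b))) ->
     (exists b, extends m (rcons h (a', b))) -> a = a').
Proof.
split=> [a m [b /extends_rcons] //|a a' m [b e] [b' e']].
by have [] := extends_uniq e e'.
Qed.

Let N_family h a :
  (forall b m, extends m (rcons h (a, b)) -> exists b, extends m (rcons h (a, b))) /\
  (forall b b' m, extends m (rcons h (a, b)) -> extends m (rcons h (a, b')) -> b = b').
Proof.
split=> [b m e|b b' m e e']; first by exists b.
by have [] := extends_uniq e e'.
Qed.

Lemma first_kernel_bounds h a : 0 <= first_kernel h a <= 1.
Proof.
apply: ratio_bounds; rewrite mass_ge0.
have [H1 H2] := N1_family h.
exact: (@mass_family1 _ (fun a => [set m | exists b, extends m (rcons h (a, b))])).
Qed.

Lemma second_kernel_bounds h a b : 0 <= second_kernel h a b <= 1.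
Proof.
apply: ratio_bounds; rewrite mass_ge0.
have [H1 H2] := N_family h a.
exact: (@mass_family1 _ (fun b => [set m | extends m (rcons h (a, b))])).
Qed.

Let esum_ratio (I : choiceType) (u : I -> R) (v : R) : (forall i, 0 <= u i) -> 0 <= v ->
  (\esum_(i in [set: I]) (u i)%:E <= v%:E)%E ->
  (\esum_(i in [set: I]) (u i / v)%:E <= 1)%E.
Proof.
move=> u0 v0 uv; have [->|vn0] := eqVneq v 0.
  by rewrite esum1 // => i _; rewrite invr0 mulr0.
rewrite (eq_esum (b := fun i => (v^-1)%:E * (u i)%:E)%E); last first.
  by move=> i _; rewrite -EFinM mulrC.
rewrite esumZl; [|by rewrite invr_ge0|by move=> i; rewrite lee_fin].
apply: (@le_trans _ _ ((v^-1)%:E * v%:E)%E).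
  by apply: lee_wpmul2l => //; rewrite lee_fin invr_ge0.
by rewrite -EFinM mulVf.
Qed.

Lemma first_kernel_sum h : (\esum_(a in [set: word]) (first_kernel h a)%:E <= 1)%E.
Proof.
have [H1 H2] := N1_family h.
apply: esum_ratio; [by move=> a; exact: mass_ge0|exact: mass_ge0|].
exact: (@mass_family _ (fun a => [set m | exists b, extends m (rcons h (a, b))])).
Qed.

Lemma second_kernel_sum h a : (\esum_(b in [set: word]) (second_kernel h a b)%:E <= 1)%E.
Proof.
have [H1 H2] := N_family h a.
apply: esum_ratio; [by move=> b; exact: mass_ge0|exact: mass_ge0|].
exact: (@mass_family _ (fun b => [set m | extends m (rcons h (a, b))])).
Qed.

Hypothesis p_decodes : forall m, p m != 0 -> exists T, forall S, (T <= S)%N -> dec c1 c2 m S.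

(** Along the decoded history [g] the product of both kernels telescopes to [N g / N [::]]. This is
    at least [p m], because [m] itself extends [g] and [N [::]] is at most 1. *)
Lemma kernel_split m :
  p m <= link_weight c1 c2 (fun h r => first_kernel h r.1) m
       * link_weight c1 c2 (fun h r => second_kernel h r.1 r.2) m.
Proof.
have b1 : bounded (fun (h h' : hist) (r r' : word * word) => first_kernel h r.1).
  by move=> h h' r r'; exact: first_kernel_bounds.
have b2 : bounded (fun (h h' : hist) (r r' : word * word) => second_kernel h r.1 r.2).
  by move=> h h' r r'; exact: second_kernel_bounds.
have [->|pm] := eqVneq (p m) 0; first by rewrite mulr_ge0 // wlim_ge0.
have [T HT] := p_decodes pm.
have p0 : 0 < p m by rewrite lt_neqAle eq_sym pm p_ge0.
have w12 := limn_mul (wdec_cvg pf1 pf2 pf1 pf2 (m := m) (m' := m) b1)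
                 (wdec_cvg pf1 pf2 pf1 pf2 (m := m) (m' := m) b2).
rewrite /link_weight /wlim -(cvg_lim _ w12) //.
apply: limr_ge; first by apply/cvg_ex; eexists; exact: w12.
exists T => // S /HT /=; rewrite /wdec; case e: dec => [g|//] _.
(* Every denominator met along the decoding of [m] is at least [p m > 0], so the convention for a
   zero denominator never intervenes. *)
have Ng t : (t <= S)%N -> p m <= N (take t g).
  move=> tS; apply: mass_ge; exists S, g; have /decP[//|//|_ sg _] := e.
  by rewrite size_takel ?sg.
have N1g t : (t < S)%N -> p m <= N1 (take t g) (ent g t).1.
  move=> tS; apply: mass_ge; exists (ent g t).2; exists S, g.
  have /decP[//|//|_ sg _] := e.
  rewrite size_rcons size_takel ?sg ?(ltnW tS) // -surjective_pairing.
  by rewrite -take_nth ?sg.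
have [_ sg _] : [/\ valid c1 c2 g, size g = S & transcript g = m] by apply/decP.
have nz (u : R) : p m <= u -> u != 0 by move=> pu; rewrite lt0r_neq0 // (lt_le_trans p0).
rewrite /weight -big_split /=.
have N0 : N [::] != 0 by rewrite nz //; have := Ng 0 (leq0n _); rewrite take0.
have telescope S' : (S' <= S)%N -> \prod_(t < S') (first_kernel (take t g) (ent g t).1 *
     second_kernel (take t g) (ent g t).1 (ent g t).2) = N (take S' g) / N [::].
  elim: S' => [|S' IH] S'S; first by rewrite big_ord0 take0 divff.
  rewrite big_ord_recr /= IH ?(ltnW S'S) //.
  rewrite (take_nth ([::], [::])) ?sg // /first_kernel /second_kernel.
  rewrite -surjective_pairing; field.
  by rewrite N0 !nz ?Ng ?N1g ?(ltnW S'S).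
rewrite telescope // -sg take_size.
apply: (@le_trans _ _ (N g)); first by have := Ng S (leqnn _); rewrite -sg take_size.
rewrite ler_pdivlMr; last by apply: lt_le_trans p0 _; have := Ng 0 (leq0n _); rewrite take0.
by rewrite ler_piMr ?mass_ge0 ?mass_le1.
Qed.

End split.

(* [K] is a party, with its outgoing link (on which it speaks first) decoded by
   [c1], [c2] and its incoming link by [d1], [d2].  Replacing what the others do by
   [g] and [f] is a legitimate interaction: [g] answers the party's message and [f]
   speaks before it. *)
Lemma party_check (c1 c2 d1 d2 : hist -> word -> bool) (K : hist -> hist -> word * word -> R)
    (g : hist -> word -> word -> R) (f : hist -> word -> R) :
  (forall h, prefix_free (c1 h)) -> (forall h, prefix_free (c2 h)) ->
  (forall h, prefix_free (d1 h)) -> (forall h, prefix_free (d2 h)) ->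
  (forall h h' w, 0 <= K h h' w) ->
  (forall h h', \esum_(w in [set: word * word]) (K h h' w)%:E <= 1)%E ->
  (forall h a b, 0 <= g h a b <= 1) ->
  (forall h a, \esum_(b in [set: word]) (g h a b)%:E <= 1)%E ->
  (forall h a, 0 <= f h a <= 1) ->
  (forall h, \esum_(a in [set: word]) (f h a)%:E <= 1)%E ->
  (\esum_(w in [set: word * word])
     (wlim c1 c2 d1 d2 (fun h h' r r' => K h h' (r.1, r'.2)) w.1 w.2
      * link_weight c1 c2 (fun h r => g h r.1 r.2) w.1
      * link_weight d1 d2 (fun h r => f h r.1) w.2)%:E <= 1)%E.
Proof.
move=> pc1 pc2 pd1 pd2 K0 K1 gb g1 fb f1.
have Kb h h' w : 0 <= K h h' w <= 1.
  rewrite K0 -lee_fin /=; apply: le_trans (K1 h h').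
  by apply: (@le_esum_term _ _ (fun w => (K h h' w)%:E)) => i; rewrite lee_fin.
have f0 h a : 0 <= f h a by case/andP: (fb h a).
have g0 h a b : 0 <= g h a b by case/andP: (gb h a b).
pose k (h h' : hist) (r r' : word * word) : R := K h h' (r.1, r'.2) * g h r.1 r.2 * f h' r'.1.
have kb : bounded k.
  move=> h h' r r'; rewrite /k !mulr_ge0 //=.
  have /andP[_ x1] := Kb h h' (r.1, r'.2); have /andP[_ y1] := gb h r.1 r.2.
  have /andP[_ z1] := fb h' r'.1.
  by rewrite !mulr_ile1 // mulr_ge0.
have b1 : bounded (fun h h' (r r' : word * word) => K h h' (r.1, r'.2)) by move=> *; exact: Kb.
have b2 : bounded (fun h (h' : hist) (r r' : word * word) => g h r.1 r.2) by move=> *; exact: gb.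
have b3 : bounded (fun h (h' : hist) (r r' : word * word) => f h r.1) by move=> *; exact: fb.
(* The three weights decode the same two words, so their product is the weight of the product
   kernel, already before the limit. *)
rewrite (eq_esum (b := fun w => (wlim c1 c2 d1 d2 k w.1 w.2)%:E)); last first.
  move=> [m m'] _ /=; congr EFin; apply/esym.
  have c := limn_mul3 (wdec_cvg pc1 pc2 pd1 pd2 (m := m) (m' := m') b1)
                      (wdec_cvg pc1 pc2 pc1 pc2 (m := m) (m' := m) b2)
                      (wdec_cvg pd1 pd2 pd1 pd2 (m := m') (m' := m') b3).
  rewrite /link_weight /wlim -(cvg_lim _ c) //.
  apply: (congr1 (fun u : R^nat => limn u)); apply/funext => T; rewrite /wdec.
  case: dec => [h|]; last by rewrite !mul0r.
  case: dec => [h'|]; last by rewrite mulr0.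
  by rewrite /weight -!big_split.
apply: wlim_total => // h h'.
(* The four messages are regrouped into the two sent by the party and the two received, so that the
   received ones can be summed out first. *)
pose e (r : (word * word) * (word * word)) := ((r.1.1, r.2.2), (r.1.2, r.2.1)).
apply: (@le_trans _ _ (\esum_(s in [set: (word * word) * (word * word)])
   (K h h' s.1 * g h s.1.1 s.2.1 * f h' s.2.2)%:E)%E).
  apply: (@esum_inj_le _ _ _ _ e) => //.
  - by move=> [[? ?] [? ?]] [[? ?] [? ?]] _ _ [-> -> -> ->].
  - by move=> s; rewrite lee_fin !mulr_ge0.
rewrite esum_pair; last by move=> s; rewrite lee_fin !mulr_ge0.
apply: le_trans (K1 h h'); apply: le_esum => w _ /=.
rewrite (eq_esum (b := fun s => (K h h' w)%:E * (g h w.1 s.1 * f h' s.2)%:E)%E); last first.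
  by move=> s _; rewrite -EFinM mulrA.
rewrite esumZl //; last by move=> s; rewrite lee_fin mulr_ge0.
rewrite -[X in (_ <= X)%E]mule1; apply: lee_wpmul2l; first by rewrite lee_fin.
rewrite esum_pair; last by move=> s; rewrite lee_fin mulr_ge0.
apply: le_trans (g1 h w.1); apply: le_esum => a _ /=.
rewrite (eq_esum (b := fun s => (g h w.1 a)%:E * (f h' s)%:E)%E); last first.
  by move=> s _; rewrite -EFinM.
rewrite esumZl //; last by move=> s; rewrite lee_fin.
by rewrite -[X in (_ <= X)%E]mule1; apply: lee_wpmul2l; rewrite ?lee_fin.
Qed.

End link_weight.

Lemma wlim_swap (R : realType) (c1 c2 d1 d2 : hist -> word -> bool) (k : kernel) m m' :
  wlim c1 c2 d1 d2 k m m' = wlim d1 d2 c1 c2 (fun h h' r r' => k h' h r' r) m' m :> R.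
Proof.
apply: (congr1 (fun u : R^nat => limn u)); apply/funext => T.
by rewrite /wdec; case: dec => [h|]; case: dec.
Qed.

(** * The transcript law of a protocol *)

Section protocol.
Context {R : realType} {A B C : finType}.
Variable P : protocol R A B C.
Hypothesis wfP : wf_protocol P.

Let pf12 h : prefix_free (code12 P h). Proof. by case: wfP => -[]. Qed.
Let pf21 h : prefix_free (code21 P h). Proof. by case: wfP => -[]. Qed.
Let pf23 h : prefix_free (code23 P h). Proof. by case: wfP => -[]. Qed.
Let pf32 h : prefix_free (code32 P h). Proof. by case: wfP => _ [[]]. Qed.
Let pf31 h : prefix_free (code31 P h). Proof. by case: wfP => _ [[]]. Qed.
Let pf13 h : prefix_free (code13 P h). Proof. by case: wfP => _ [[]]. Qed.

Lemma pmf_bounds (T : choiceType) (k : T -> R) t : is_pmf k -> 0 <= k t <= 1.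
Proof.
move=> [k0 k1]; rewrite k0 -lee_fin -k1.
by apply: (@le_esum_term _ _ (EFin \o k)) => i; rewrite lee_fin.
Qed.

Let alice_pmf x h h' : is_pmf (alice P x h h').
Proof. by case: wfP => _ [_ [H _ _ _]]; case: (H x h h'). Qed.
Let bob_pmf y h h' : is_pmf (bob P y h h').
Proof. by case: wfP => _ [_ [_ H _ _]]; case: (H y h h'). Qed.
Let charlie_pmf h h' : is_pmf (charlie P h h').
Proof. by case: wfP => _ [_ [_ _ H _]]; case: (H h h'). Qed.

Let kA x : @kernel R := fun h h' r r' => alice P x h h' (r.1, r'.2).
Let kB y : @kernel R := fun h h' r r' => bob P y h h' (r.2, r'.1).
Let kC : @kernel R := fun h h' r r' => charlie P h h' (r.2, r'.1).

Let kA_bounded x : bounded (kA x).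
Proof. by move=> h h' r r'; exact: (pmf_bounds _ (alice_pmf x h h')). Qed.
Let kB_bounded y : bounded (kB y).
Proof. by move=> h h' r r'; exact: (pmf_bounds _ (bob_pmf y h h')). Qed.
Let kC_bounded : bounded kC.
Proof. by move=> h h' r r'; exact: (pmf_bounds _ (charlie_pmf h h')). Qed.

Definition alice_weight x (w : word * word) : R :=
  wlim (code12 P) (code21 P) (code31 P) (code13 P) (kA x) w.1 w.2.
Definition bob_weight y (w : word * word) : R :=
  wlim (code12 P) (code21 P) (code23 P) (code32 P) (kB y) w.1 w.2.
Definition charlie_weight (w : word * word) : R :=
  wlim (code23 P) (code32 P) (code31 P) (code13 P) kC w.1 w.2.

Lemma alice_weight_ge0 x w : 0 <= alice_weight x w. Proof. exact: wlim_ge0. Qed.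
Lemma bob_weight_ge0 y w : 0 <= bob_weight y w. Proof. exact: wlim_ge0. Qed.
Lemma charlie_weight_ge0 w : 0 <= charlie_weight w. Proof. exact: wlim_ge0. Qed.

Lemma hist_probE x y T H12 H23 H31 :
  size H12 = T -> size H23 = T -> size H31 = T ->
  hist_prob P x y T H12 H23 H31 =
  weight (kA x) T H12 H31 * weight (kB y) T H12 H23 * weight kC T H23 H31.
Proof.
move=> s1 s2 s3; rewrite /hist_prob s1 s2 s3 !eqxx /= /weight -!big_split /=.
by apply: eq_bigr.
Qed.

Lemma hist_prob_valid x y T H12 H23 H31 : hist_prob P x y T H12 H23 H31 != 0 ->
  [/\ valid (code12 P) (code21 P) H12 /\ size H12 = T,
      valid (code23 P) (code32 P) H23 /\ size H23 = T
    & valid (code31 P) (code13 P) H31 /\ size H31 = T].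
Proof.
rewrite /hist_prob; case: ifP => [/and3P[/eqP s1 /eqP s2 /eqP s3]|]; last by rewrite eqxx.
move=> /prodf_neq0 nz.
have H t : (t < T)%N -> [/\ code12 P (take t H12) (ent H12 t).1,
    code21 P (take t H12) (ent H12 t).2, code23 P (take t H23) (ent H23 t).1,
    code32 P (take t H23) (ent H23 t).2 & code31 P (take t H31) (ent H31 t).1
    /\ code13 P (take t H31) (ent H31 t).2].
  move=> tT; have := nz (Ordinal tT) isT; rewrite /round_prob /= !mulf_eq0 !negb_or.
  case/andP => /andP[a0 b0] c0; case: wfP => _ [_ [HA HB HC _]].
  have [_ /(_ _ a0)[? ?]] := HA x (take t H12) (take t H31).
  have [_ /(_ _ b0)[? ?]] := HB y (take t H12) (take t H23).
  by have [_ /(_ _ c0)[? ?]] := HC (take t H23) (take t H31).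
by split; split=> // t; rewrite ?s1 ?s2 ?s3 => /H[? ? ? ? [? ?]]; apply/andP.
Qed.

(** By unique decoding at most one triple of histories contributes to the sum, and its probability
    regroups by party. *)
Lemma partial_probE x y T m : partial_prob P x y T m =
  (wdec (code12 P) (code21 P) (code31 P) (code13 P) (kA x) m.1.1 m.2 T
   * wdec (code12 P) (code21 P) (code23 P) (code32 P) (kB y) m.1.1 m.1.2 T
   * wdec (code23 P) (code32 P) (code31 P) (code13 P) kC m.1.2 m.2 T)%:E.
Proof.
case: m => -[a b] c; rewrite /partial_prob /wdec /=.
have zero : (forall H : hist * hist * hist, hist_prob P x y T H.1.1 H.1.2 H.2 != 0 ->
    transcript H.1.1 = a -> transcript H.1.2 = b -> transcript H.2 = c -> False) ->
    (\esum_(H in [set H : hist * hist * hist |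
      [/\ transcript H.1.1 = a, transcript H.1.2 = b & transcript H.2 = c]])
      (hist_prob P x y T H.1.1 H.1.2 H.2)%:E = 0)%E.
  move=> nH; apply: esum1 => H [/= ta tb tc]; congr EFin.
  by apply: contrapT => /eqP h0; exact: (nH H).
case e1: (dec (code12 P) (code21 P) a T) => [h12|] /=; last first.
  rewrite !(mul0r, mulr0) zero // => -[[g1 g2] g3] /= /hist_prob_valid[[v1 s1] _ _] ta _ _.
  by have : dec (code12 P) (code21 P) a T = Some g1 by [apply/decP]; rewrite e1.
case e3: (dec (code31 P) (code13 P) c T) => [h31|] /=; last first.
  rewrite !(mul0r, mulr0) zero // => -[[g1 g2] g3] /= /hist_prob_valid[_ _ [v1 s1]] _ _ tc.
  by have : dec (code31 P) (code13 P) c T = Some g3 by [apply/decP]; rewrite e3.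
case e2: (dec (code23 P) (code32 P) b T) => [h23|] /=; last first.
  rewrite !(mul0r, mulr0) zero // => -[[g1 g2] g3] /= /hist_prob_valid[_ [v1 s1] _] _ tb _.
  by have : dec (code23 P) (code32 P) b T = Some g2 by [apply/decP]; rewrite e2.
have /decP[//|//|v1 s1 t1] := e1; have /decP[//|//|v2 s2 t2] := e2.
have /decP[//|//|v3 s3 t3] := e3.
rewrite -hist_probE // esum_mkcond (esum_single (t := (h12, h23, h31))) /=.
- by rewrite mem_set.
- by case: ifP => // _; rewrite lee_fin hist_probE // !mulr_ge0 // weight_ge0.
- move=> [[g1 g2] g3] gh; case: ifPn => // /set_mem [/= ta tb tc].
  congr EFin; apply: contrapT => /eqP /hist_prob_valid[[w1 z1] [w2 z2] [w3 z3]].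
  have d1 : dec (code12 P) (code21 P) a T = Some g1 by apply/decP.
  have d2 : dec (code23 P) (code32 P) b T = Some g2 by apply/decP.
  have d3 : dec (code31 P) (code13 P) c T = Some g3 by apply/decP.
  move: d1 d2 d3; rewrite e1 e2 e3 => -[?] [?] [?]; subst.
  by rewrite eqxx in gh.
Qed.

Definition transcript_prob x y (m : word * word * word) : R :=
  alice_weight x (m.1.1, m.2) * bob_weight y m.1 * charlie_weight (m.1.2, m.2).

Lemma transcript_prob_ge0 x y m : 0 <= transcript_prob x y m.
Proof. by rewrite !mulr_ge0 // ?alice_weight_ge0 ?bob_weight_ge0 ?charlie_weight_ge0. Qed.

(** Each party's sequence converges on its own, so the product form survives the limit. *)
Lemma final_probE x y m : final_prob P x y m = (transcript_prob x y m)%:E.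
Proof.
rewrite /final_prob; apply/cvg_lim => //.
have -> : (fun T => partial_prob P x y T m) = EFin \o (fun T =>
    wdec (code12 P) (code21 P) (code31 P) (code13 P) (kA x) m.1.1 m.2 T
   * wdec (code12 P) (code21 P) (code23 P) (code32 P) (kB y) m.1.1 m.1.2 T
   * wdec (code23 P) (code32 P) (code31 P) (code13 P) kC m.1.2 m.2 T).
  by apply/funext => T; exact: partial_probE.
apply: cvg_EFin; first exact: nearW.
rewrite (_ : fine \o _ = fun T =>
    wdec (code12 P) (code21 P) (code31 P) (code13 P) (kA x) m.1.1 m.2 T
   * wdec (code12 P) (code21 P) (code23 P) (code32 P) (kB y) m.1.1 m.1.2 T
   * wdec (code23 P) (code32 P) (code31 P) (code13 P) kC m.1.2 m.2 T) //.
by apply: limn_mul3; exact: wdec_cvg.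
Qed.

Lemma transcript_decodes x y m : transcript_prob x y m != 0 ->
  exists T, forall S, (T <= S)%N -> [/\ dec (code12 P) (code21 P) m.1.1 S,
    dec (code23 P) (code32 P) m.1.2 S & dec (code31 P) (code13 P) m.2 S].
Proof.
rewrite !mulf_eq0 !negb_or => /andP[/andP[a0 _] c0].
have [T1 H1] := wlim_neq0 pf12 pf21 pf31 pf13 (kA_bounded x) a0.
have [T2 H2] := wlim_neq0 pf23 pf32 pf31 pf13 kC_bounded c0.
exists (maxn T1 T2) => S; rewrite geq_max => /andP[/H1[? ?] /H2[? ?]].
by split.
Qed.

Section checks.
Variables (g : hist -> word -> word -> R) (f : hist -> word -> R).
Hypotheses (gb : forall h a b, 0 <= g h a b <= 1) (fb : forall h a, 0 <= f h a <= 1).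
Hypothesis g_sum : forall h a, (\esum_(b in [set: word]) (g h a b)%:E <= 1)%E.
Hypothesis f_sum : forall h, (\esum_(a in [set: word]) (f h a)%:E <= 1)%E.

Local Notation G c1 c2 := (link_weight c1 c2 (fun h r => g h r.1 r.2)).
Local Notation F c1 c2 := (link_weight c1 c2 (fun h r => f h r.1)).

Let swap_sum (a : word * word -> R) : (forall w, 0 <= a w) ->
  (\esum_(w in [set: word * word]) (a (w.2, w.1))%:E
   <= \esum_(w in [set: word * word]) (a w)%:E)%E.
Proof.
move=> a0; apply: (@esum_inj_le _ _ _ _ (fun w : word * word => (w.2, w.1))) => //.
by move=> [? ?] [? ?] _ _ [-> ->].
Qed.

Lemma alice_check x : (\esum_(w in [set: word * word])
  (alice_weight x w * G (code12 P) (code21 P) w.1 * F (code31 P) (code13 P) w.2)%:E <= 1)%E.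
Proof.
apply: (@party_check _ _ _ _ _ (fun h h' => alice P x h h')) => //.
- by move=> h h'; have [] := alice_pmf x h h'.
- by move=> h h'; have [_ ->] := alice_pmf x h h'.
Qed.

(** Bob speaks first on link 23 and answers on link 12, so his two links are exchanged before
    [party_check] applies. *)
Lemma bob_check y :
  (\esum_(w in [set: word * word])
    (bob_weight y w * F (code12 P) (code21 P) w.1 * G (code23 P) (code32 P) w.2)%:E <= 1)%E.
Proof.
pose K h h' (w : word * word) := bob P y h' h (w.2, w.1).
pose a (w : word * word) :=
  wlim (code23 P) (code32 P) (code12 P) (code21 P) (fun h h' r r' => K h h' (r.1, r'.2)) w.1 w.2
  * G (code23 P) (code32 P) w.1 * F (code12 P) (code21 P) w.2.
have a0 w : 0 <= a w.
  apply: mulr_ge0; [apply: mulr_ge0|]; apply: wlim_ge0 => //.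
  by move=> h h' r r'; exact: (kB_bounded y).
apply: (@le_trans _ _ (\esum_(w in [set: word * word]) (a (w.2, w.1))%:E)%E).
  by apply: le_esum => w _; rewrite /a /bob_weight wlim_swap mulrAC.
apply: le_trans (swap_sum a0) _; apply: party_check => //.
- by move=> h h' w; have [k0 _] := bob_pmf y h' h; exact: k0.
- by move=> h h'; have [k0 <-] := bob_pmf y h' h; exact: swap_sum.
Qed.

Lemma charlie_check :
  (\esum_(w in [set: word * word])
    (charlie_weight w * F (code23 P) (code32 P) w.1 * G (code31 P) (code13 P) w.2)%:E <= 1)%E.
Proof.
pose K h h' (w : word * word) := charlie P h' h (w.2, w.1).
pose a (w : word * word) :=
  wlim (code31 P) (code13 P) (code23 P) (code32 P) (fun h h' r r' => K h h' (r.1, r'.2)) w.1 w.2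
  * G (code31 P) (code13 P) w.1 * F (code23 P) (code32 P) w.2.
have a0 w : 0 <= a w.
  apply: mulr_ge0; [apply: mulr_ge0|]; apply: wlim_ge0 => //.
  by move=> h h' r r'; exact: kC_bounded.
apply: (@le_trans _ _ (\esum_(w in [set: word * word]) (a (w.2, w.1))%:E)%E).
  by apply: le_esum => w _; rewrite /a /charlie_weight wlim_swap mulrAC.
apply: le_trans (swap_sum a0) _; apply: party_check => //.
- by move=> h h' w; have [k0 _] := charlie_pmf h' h; exact: k0.
- by move=> h h'; have [k0 <-] := charlie_pmf h' h; exact: swap_sum.
Qed.

End checks.

(** * Joint law of inputs, output and transcripts; consequences of privacy *)

Section outcomes.
Variables (pXY : A -> B -> R) (f : A -> B -> C).
Hypothesis pXY_gt0 : forall x y, 0 < pXY x y.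
Hypothesis pXY_sum : \sum_x \sum_y pXY x y = 1.
Hypothesis P_terminates : terminates P.
Hypothesis P_correct : correct f P.

Local Notation Q := transcript_prob.
Local Notation EQ x y := (EFin \o Q x y).
Local Notation M := (word * word * word)%type.

Lemma EQ_ge0 x y m : (0 <= EQ x y m)%E.
Proof. by rewrite lee_fin transcript_prob_ge0. Qed.

Lemma transcript_prob_total x y : (\esum_(m in [set: M]) (Q x y m)%:E = 1)%E.
Proof. by rewrite -(P_terminates x y); apply: eq_esum => m _; rewrite final_probE. Qed.

Lemma output_correct x y m z : Q x y m != 0 ->
  output P m.1.2 m.2 z = if z == f x y then 1 else 0.
Proof.
move=> Q0; have [_ [_ [_ _ _ H]]] := wfP; have [out0 out1] := H m.1.2 m.2.
have zero z' : z' != f x y -> output P m.1.2 m.2 z' = 0.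
  apply: contraNeq => oz; apply/eqP; apply: (P_correct (m := m)).
  by rewrite final_probE -EFinM; apply/eqP => -[] /eqP; rewrite mulf_eq0 (negbTE Q0) (negbTE oz).
have [->|/zero//] := eqVneq.
by rewrite -out1 (bigD1 (f x y)) //= big1 ?addr0 // => i /zero.
Qed.

Lemma determines_output x y x' y' a a' b c :
  Q x y (a, b, c) != 0 -> Q x' y' (a', b, c) != 0 -> f x y = f x' y'.
Proof.
move=> /output_correct H /output_correct H'.
have := etrans (esym (H' (f x y))) (H (f x y)).
by rewrite eqxx; case: eqP => // _ /esym/eqP; rewrite oner_eq0.
Qed.

Lemma joint_ge0 o : (0 <= joint pXY P o)%E.
Proof.
case: o => -[[x y] z] m; rewrite /joint final_probE -!EFinM lee_fin.
have [_ [_ [_ _ _ H]]] := wfP; have [out0 _] := H m.1.2 m.2.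
apply: mulr_ge0 => //; apply: mulr_ge0; [exact/ltW|exact: transcript_prob_ge0].
Qed.

(** On the support correctness makes the output kernel a point mass at [f x y], so the output
    coordinate can be eliminated. *)
Lemma law_joint (V : choiceType) (U : outcome A B C -> V) v :
  (law (joint pXY P) U v
   = \sum_x \sum_y (pXY x y)%:E * law (EQ x y) (fun m => U (x, y, f x y, m)) v)%E.
Proof.
pose F o := (joint pXY P o * (if U o == v then 1 else 0)%:E)%E.
have F0 o : (0 <= F o)%E by rewrite mule_ge0 ?joint_ge0 // lee_fin; case: ifP.
rewrite lawE -/F (@esum_pair _ _ _ F) //.
have in0 t : (0 <= \esum_(m in [set: M]) F (t, m))%E by apply: esum_ge0.
rewrite (@esum_pair _ _ _ (fun t => \esum_(m in [set: M]) F (t, m))%E) //.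
rewrite esum_pair; last by move=> t; apply: esum_ge0.
rewrite esum_fin; last by move=> x; apply: esum_ge0 => y _; apply: esum_ge0.
apply: eq_bigr => x _.
rewrite esum_fin; last by move=> y; apply: esum_ge0.
apply: eq_bigr => y _.
rewrite lawE -esumZl ?(ltW (pXY_gt0 _ _)) //; last first.
  by move=> m; rewrite mule_ge0 ?EQ_ge0 // lee_fin; case: ifP.
have outE z m : F (x, y, z, m) = if z == f x y
   then ((pXY x y)%:E * (EQ x y m * (if U (x, y, f x y, m) == v then 1 else 0)%:E))%E else 0%E.
  rewrite /F /joint final_probE /=; have [Q0|/output_correct ->] := eqVneq (Q x y m) 0.
    by rewrite Q0 mule0 !mul0e mule0; case: ifP.
  by case: eqP => [->|_]; rewrite ?mule1 ?muleA // mule0 mul0e.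
rewrite (esum_single (t := f x y)) //; last first.
  by move=> z zf; apply: esum1 => m _; rewrite outE (negbTE zf).
by apply: eq_esum => m _; rewrite outE eqxx.
Qed.

Lemma EQ_law_fin (V : choiceType) x y (U : M -> V) v :
  law (EQ x y) U v = (fine (law (EQ x y) U v))%:E.
Proof.
rewrite fineK // ge0_fin_numE ?law_ge0 //; last exact: EQ_ge0.
apply: le_lt_trans (ltry 1); rewrite -(transcript_prob_total x y).
by apply: law_le_total; exact: EQ_ge0.
Qed.

Lemma law_const (V : choiceType) x y (v v' : V) :
  law (EQ x y) (fun=> v) v' = if v == v' then 1%E else 0%E.
Proof.
rewrite lawE; case: eqP => _; last by apply: esum1 => m _; rewrite mule0.
by apply: etrans (transcript_prob_total x y); apply: eq_esum => m _; rewrite mule1.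
Qed.

Lemma pair_sum (F : A -> B -> \bar R) x y :
  (\sum_x' \sum_y' (if (x' == x) && (y' == y) then F x' y' else 0) = F x y)%E.
Proof.
rewrite (bigD1 x) //= [X in (_ + X)%E]big1 ?adde0; last first.
  by move=> x' /negbTE xx'; apply: big1 => y' _; rewrite xx'.
rewrite (bigD1 y) //= big1 ?adde0 ?eqxx //.
by move=> y' /negbTE ->; rewrite andbF.
Qed.

Lemma joint_total :
  (\esum_(o in [set: outcome A B C]) joint pXY P o = 1)%E.
Proof.
rewrite -(esum_law (fun=> tt) joint_ge0) (esum_single (t := tt)).
- rewrite law_joint; under eq_bigr do under eq_bigr do rewrite law_const eqxx mule1.
  by under eq_bigr do rewrite sumEFin; rewrite sumEFin pXY_sum.
- exact/law_ge0/joint_ge0.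
- by case.
Qed.

Lemma joint_law_fin (V : choiceType) (U : outcome A B C -> V) v :
  law (joint pXY P) U v = (fine (law (joint pXY P) U v))%:E.
Proof.
rewrite fineK // ge0_fin_numE ?law_ge0 //; try exact: joint_ge0.
apply: le_lt_trans (ltry 1); rewrite -joint_total.
by apply: law_le_total; exact: joint_ge0.
Qed.

(** Here [v] is what a party may know and [w] is the rest; together they determine the inputs. The
    Markov identity then says that [pXY x y] times the law of [U] at [(x, y)] is [pXY x y] times a
    conditional law given [v], and full support allows the cancellation. *)
Lemma privacy (T V W : choiceType) (Uo : outcome A B C -> T) (Vo : outcome A B C -> V)
    (Wo : outcome A B C -> W) (U : M -> T) (v : A -> B -> V) (w : A -> B -> W) :
  (forall x y m, Uo (x, y, f x y, m) = U m) ->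
  (forall x y m, Vo (x, y, f x y, m) = v x y) ->
  (forall x y m, Wo (x, y, f x y, m) = w x y) ->
  (forall x y x' y', v x y = v x' y' -> w x y = w x' y' -> x = x' /\ y = y') ->
  Defs.markov (joint pXY P) Uo Vo Wo ->
  forall x y x' y', v x y = v x' y' -> forall u, law (EQ x y) U u = law (EQ x' y') U u.
Proof.
move=> UE VE WE inj mk x y x' y' vv u.
have vw x0 y0 x1 y1 : (v x1 y1 == v x0 y0) && (w x1 y1 == w x0 y0)
    = (x1 == x0) && (y1 == y0).
  apply/andP/andP => -[/eqP e1 /eqP e2]; last by rewrite e1 e2.
  by have [-> ->] := inj _ _ _ _ e1 e2.
have lawUVW x0 y0 : law (joint pXY P) (fun o => (Uo o, Vo o, Wo o)) (u, v x0 y0, w x0 y0)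
    = ((pXY x0 y0)%:E * law (EQ x0 y0) U u)%E.
  rewrite law_joint.
  rewrite -(pair_sum (fun x0 y0 => (pXY x0 y0)%:E * law (EQ x0 y0) U u)%E x0 y0).
  apply: eq_bigr => x1 _; apply: eq_bigr => y1 _.
  have mask m : ((Uo (x1, y1, f x1 y1, m), Vo (x1, y1, f x1 y1, m), Wo (x1, y1, f x1 y1, m))
      == (u, v x0 y0, w x0 y0)) = ((x1 == x0) && (y1 == y0)) && (U m == u).
    by rewrite UE VE WE !xpair_eqE -vw -andbA andbC.
  by rewrite (law_mask _ mask); case: ifP => [/andP[/eqP -> /eqP ->]|]; rewrite ?mule0.
have lawVW x0 y0 : law (joint pXY P) (fun o => (Vo o, Wo o)) (v x0 y0, w x0 y0)
    = (pXY x0 y0)%:E.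
  rewrite law_joint -(pair_sum (fun x0 y0 => (pXY x0 y0)%:E) x0 y0).
  apply: eq_bigr => x1 _; apply: eq_bigr => y1 _.
  have mask m : ((Vo (x1, y1, f x1 y1, m), Wo (x1, y1, f x1 y1, m)) == (v x0 y0, w x0 y0))
      = ((x1 == x0) && (y1 == y0)) && (tt == tt).
    by rewrite VE WE xpair_eqE -vw andbT.
  rewrite (law_mask (U' := fun=> tt) _ mask) law_const eqxx.
  by case: ifP => [/andP[/eqP -> /eqP ->]|]; rewrite ?mule0 ?mule1.
have vpos : 0 < fine (law (joint pXY P) Vo (v x y)).
  apply: lt_le_trans (pXY_gt0 x y) _; rewrite -lee_fin -joint_law_fin -lawVW.
  have -> : law (joint pXY P) Vo (v x y)
      = law (law (joint pXY P) (fun o => (Vo o, Wo o))) fst (v x y).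
    by rewrite law_comp //; exact: joint_ge0.
  apply: (law_term fst (v x y, w x y)).
  by move=> o; apply: law_ge0; exact: joint_ge0.
have := mk u (v x y) (w x y); have := mk u (v x' y') (w x' y').
rewrite !lawUVW !lawVW -vv.
rewrite (joint_law_fin Vo) (joint_law_fin (fun o => (Uo o, Vo o)))
        (EQ_law_fin x y U u) (EQ_law_fin x' y' U u).
rewrite -!EFinM => -[e'] [e]; congr EFin.
have p0 := lt0r_neq0 (pXY_gt0 x y); have p0' := lt0r_neq0 (pXY_gt0 x' y').
apply: (mulIf (lt0r_neq0 vpos)).
have := mulfI p0 (etrans (mulrA _ _ _) (etrans e (mulrC _ _))) => ->.
by have := mulfI p0' (etrans (mulrA _ _ _) (etrans e' (mulrC _ _))) => ->.
Qed.

End outcomes.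

End protocol.

Lemma log2_le0 (R : realType) (t : R) : 0 <= t <= 1 -> log2 t <= 0.
Proof.
move=> /andP[t0 t1]; rewrite /log2 pmulr_lle0 ?ln_le0 //.
by rewrite invr_gt0 ln_gt0 // ltr1n.
Qed.

(** * Secure protocols for the component-wise AND *)

Section component_AND.
Context {R : realType} {n : nat}.
Variables (pXY : bits n -> bits n -> R) (P : protocol R (bits n) (bits n) (bits n)).
Hypothesis pXY_gt0 : forall x y, 0 < pXY x y.
Hypothesis pXY_sum : \sum_x \sum_y pXY x y = 1.
Hypothesis P_secure : secure pXY (@AND n) P.

Local Notation M := (word * word * word)%type.
Local Notation Q := (transcript_prob P).
Local Notation EQ x y := (EFin \o Q x y).
Local Notation J := (joint pXY P).

Let wfP : wf_protocol P. Proof. by case: P_secure. Qed.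
Let P_terminates : terminates P. Proof. by case: P_secure. Qed.
Let P_correct : correct (@AND n) P. Proof. by case: P_secure. Qed.
Let Q_ge0 x y m : 0 <= Q x y m. Proof. exact: transcript_prob_ge0. Qed.
Let EQ_ge0 x y m : (0 <= EQ x y m)%E. Proof. by rewrite lee_fin. Qed.
Let Q_total x y : (\esum_(m in [set: M]) (Q x y m)%:E = 1)%E.
Proof. exact: transcript_prob_total. Qed.

Let pf12 h : prefix_free (code12 P h). Proof. by case: wfP => -[]. Qed.
Let pf21 h : prefix_free (code21 P h). Proof. by case: wfP => -[]. Qed.
Let pf23 h : prefix_free (code23 P h). Proof. by case: wfP => -[]. Qed.
Let pf32 h : prefix_free (code32 P h). Proof. by case: wfP => _ [[]]. Qed.
Let pf31 h : prefix_free (code31 P h). Proof. by case: wfP => _ [[]]. Qed.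
Let pf13 h : prefix_free (code13 P h). Proof. by case: wfP => _ [[]]. Qed.

Lemma alice_privacy x y y' w :
  law (EQ x y) (fun m => (m.1.1, m.2)) w = law (EQ x y') (fun m => (m.1.1, m.2)) w.
Proof.
have [_ _ _ [H _ _]] := P_secure.
apply: (privacy wfP pXY_gt0 pXY_sum P_terminates P_correct
  (v := fun x _ => x) (w := fun x y => (y, AND x y)) _ _ _ _ H) => //.
by move=> x1 y1 x2 y2 -> [-> _].
Qed.

Lemma bob_privacy x x' y w : law (EQ x y) fst w = law (EQ x' y) fst w.
Proof.
have [_ _ _ [_ H _]] := P_secure.
apply: (privacy wfP pXY_gt0 pXY_sum P_terminates P_correct
  (v := fun _ y => y) (w := fun x y => (x, AND x y)) _ _ _ _ H) => //.
- by move=> x1 y1 m; rewrite /oM12 /oM23 /= -surjective_pairing.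
- by move=> x1 y1 x2 y2 -> [-> _].
Qed.

Lemma charlie_privacy x y x' y' w : AND x y = AND x' y' ->
  law (EQ x y) (fun m => (m.1.2, m.2)) w = law (EQ x' y') (fun m => (m.1.2, m.2)) w.
Proof.
have [_ _ _ [_ _ H]] := P_secure => xy.
apply: (privacy wfP pXY_gt0 pXY_sum P_terminates P_correct
  (v := fun x y => AND x y) (w := fun x y => (x, y)) _ _ _ _ H) => //.
by move=> x1 y1 x2 y2 _ [-> ->].
Qed.

Let z0 : bits n := [ffun=> false].
Let z1 : bits n := [ffun=> true].
Let ANDz0 (x : bits n) : AND x z0 = z0.
Proof. by apply/ffunP => i; rewrite !ffunE andbF. Qed.
Let ANDz1 (x : bits n) : AND x z1 = x.
Proof. by apply/ffunP => i; rewrite !ffunE andbT. Qed.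
Let ANDxx (x : bits n) : AND x x = x.
Proof. by apply/ffunP => i; rewrite !ffunE andbb. Qed.
Let ANDC (x y : bits n) : AND x y = AND y x.
Proof. by apply/ffunP => i; rewrite !ffunE andbC. Qed.

Let lawF (V : choiceType) x y (U : M -> V) v :
  law (EQ x y) U v = (fine (law (EQ x y) U v))%:E.
Proof. exact: EQ_law_fin. Qed.

(** Marginals at reference inputs. Charlie's law for the output [z] is taken at the pair [(z, z)],
    whose AND is [z]. *)
Definition p12 (a : word) : R := fine (law (EQ z0 z0) (fun m => m.1.1) a).
Definition p23 (b : word) : R := fine (law (EQ z0 z0) (fun m => m.1.2) b).
Definition p31 (c : word) : R := fine (law (EQ z0 z0) snd c).
Definition p1 x w : R := fine (law (EQ x z0) (fun m => (m.1.1, m.2)) w).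
Definition p2 y w : R := fine (law (EQ z0 y) fst w).
Definition p3 z w : R := fine (law (EQ z z) (fun m => (m.1.2, m.2)) w).

Lemma law_p1 x y w : law (EQ x y) (fun m => (m.1.1, m.2)) w = (p1 x w)%:E.
Proof. by rewrite (alice_privacy x y z0) lawF. Qed.

Lemma law_p2 x y w : law (EQ x y) fst w = (p2 y w)%:E.
Proof. by rewrite (bob_privacy x z0 y) lawF. Qed.

Lemma law_p3 x y w : law (EQ x y) (fun m => (m.1.2, m.2)) w = (p3 (AND x y) w)%:E.
Proof. by rewrite (charlie_privacy (x' := AND x y) (y' := AND x y)) ?ANDxx // lawF. Qed.

Let law_via (V T : choiceType) x y x' y' (U : M -> V) (h : V -> T) t :
  (forall v, law (EQ x y) U v = law (EQ x' y') U v) ->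
  law (EQ x y) (h \o U) t = law (EQ x' y') (h \o U) t.
Proof.
move=> H; have e x1 y1 : law (EQ x1 y1) (h \o U) t = law (law (EQ x1 y1) U) h t.
  by rewrite law_comp.
by rewrite e e; congr (law _ _ _); apply/funext.
Qed.

(** Alice's privacy lets [y] vary with [x] fixed, and Bob's lets [x] vary with [y] fixed. *)
Lemma law_p12 x y a : law (EQ x y) (fun m => m.1.1) a = (p12 a)%:E.
Proof.
rewrite -lawF; transitivity (law (EQ x z0) (fun m => m.1.1) a).
  exact: (law_via (U := fun m => (m.1.1, m.2)) fst _ (alice_privacy x y z0)).
exact: (law_via (U := fst) fst _ (bob_privacy x z0 z0)).
Qed.

(** Alice's privacy moves [y] to zero; the output is then zero for every [x], so Charlie's privacy
    lets [x] vary. *)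
Lemma law_p31 x y c : law (EQ x y) snd c = (p31 c)%:E.
Proof.
rewrite -lawF; transitivity (law (EQ x z0) snd c).
  exact: (law_via (U := fun m => (m.1.1, m.2)) snd _ (alice_privacy x y z0)).
apply: (law_via (U := fun m => (m.1.2, m.2)) snd _ _) => w.
by apply: charlie_privacy; rewrite !ANDz0.
Qed.

Lemma law_p23 x y b : law (EQ x y) (fun m => m.1.2) b = (p23 b)%:E.
Proof.
rewrite -lawF; transitivity (law (EQ z0 y) (fun m => m.1.2) b).
  exact: (law_via (U := fst) snd _ (bob_privacy x z0 y)).
apply: (law_via (U := fun m => (m.1.2, m.2)) fst _ _) => w.
by apply: charlie_privacy; rewrite ![AND z0 _]ANDC !ANDz0.
Qed.

Lemma determines_z x y x' y' a a' b c :
  Q x y (a, b, c) != 0 -> Q x' y' (a', b, c) != 0 -> AND x y = AND x' y'.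
Proof. exact: determines_output. Qed.

Let law_neq0 (V : choiceType) x y (U : M -> V) v :
  law (EQ x y) U v != 0%E -> exists2 m, U m = v & Q x y m != 0.
Proof.
move=> L; apply: contrapT => nm; case/eqP: L; apply: esum1 => m Um; congr EFin.
by apply: contrapT => /eqP m0; case: nm; exists m.
Qed.

Let law_gt0 (V : choiceType) x y (U : M -> V) m : Q x y m != 0 -> law (EQ x y) U (U m) != 0%E.
Proof.
move=> m0; rewrite gt_eqF //; apply: lt_le_trans (law_term U m _); last exact: EQ_ge0.
by rewrite lte_fin lt_neqAle eq_sym m0 Q_ge0.
Qed.

(* With [y] all ones, Charlie's output is [x]; so if a transcript pair of Alice
   were possible for both [x] and [x'], he would be unable to tell them apart. *)
Lemma determines_x x y x' y' a b b' c :
  Q x y (a, b, c) != 0 -> Q x' y' (a, b', c) != 0 -> x = x'.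
Proof.
move=> H H'; have := law_gt0 (fun m => (m.1.1, m.2)) H.
rewrite (alice_privacy x y z1) => /law_neq0[[[a1 b1] c1] [/= -> ->]] H1.
rewrite -(ANDz1 x) -(ANDz1 x'); apply: (determines_z H1 (a' := a)).
(* Cut and paste in the product form: the factors of Bob and Charlie come from the run on [(x, z1)],
   that of Alice from the run on [x']. Hence the same triple is possible on [(x', z1)]. *)
move: H1 H'; rewrite /transcript_prob /= !mulf_eq0 !negb_or.
by move=> /andP[/andP[_ ->] ->] /andP[/andP[-> _] _].
Qed.

Lemma determines_y x y x' y' a b c c' :
  Q x y (a, b, c) != 0 -> Q x' y' (a, b, c') != 0 -> y = y'.
Proof.
move=> H H'; have := law_gt0 fst H.
rewrite (bob_privacy x z1 y) => /law_neq0[[[a1 b1] c1] [/= -> ->]] H1.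
rewrite -(ANDz1 y) -(ANDz1 y') ![AND _ z1]ANDC; apply: (determines_z H1 (a' := a)).
move: H1 H'; rewrite /transcript_prob /= !mulf_eq0 !negb_or.
by move=> /andP[/andP[-> _] ->] /andP[/andP[_ ->] _].
Qed.

Let fin_ge0 (V : choiceType) x y (U : M -> V) v : 0 <= fine (law (EQ x y) U v).
Proof. by rewrite fine_ge0 // law_ge0. Qed.

Lemma p12_entropy :
  ((n%:R * (ln 3 + ln 2 / 3))%:E <= \esum_(a in [set: word]) (p12 a * - ln (p12 a))%:E)%E.
Proof.
have sum1 (V : choiceType) (U : M -> V) :
    (\esum_(v in [set: V]) (fine (law (EQ z0 z0) U v))%:E <= 1)%E.
  under eq_esum do rewrite -lawF.
  by rewrite esum_law // Q_total.
have dec_of (U : M -> word) (p : word -> R) m : p m = fine (law (EQ z0 z0) U m) ->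
    p m != 0 -> exists2 t, U t = m & Q z0 z0 t != 0.
  by move=> -> pm; apply: law_neq0; apply: contra pm => /eqP ->.
have d12 a : p12 a != 0 -> exists T, forall S, (T <= S)%N -> dec (code12 P) (code21 P) a S.
  move=> /(dec_of (fun m => m.1.1) p12 a erefl)[t <- /(transcript_decodes wfP)[T H]].
  by exists T => S /H[].
have d23 b : p23 b != 0 -> exists T, forall S, (T <= S)%N -> dec (code23 P) (code32 P) b S.
  move=> /(dec_of (fun m => m.1.2) p23 b erefl)[t <- /(transcript_decodes wfP)[T H]].
  by exists T => S /H[].
have d31 c : p31 c != 0 -> exists T, forall S, (T <= S)%N -> dec (code31 P) (code13 P) c S.
  move=> /(dec_of snd p31 c erefl)[t <- /(transcript_decodes wfP)[T H]].
  by exists T => S /H[].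
have b12 : forall a, 0 <= p12 a by move=> a; exact: fin_ge0.
have b23 : forall a, 0 <= p23 a by move=> a; exact: fin_ge0.
have b31 : forall a, 0 <= p31 a by move=> a; exact: fin_ge0.
have lw_ge0 c1 c2 (k : hist -> word * word -> R) m : (forall h, prefix_free (c1 h)) ->
    (forall h, prefix_free (c2 h)) -> (forall h r, 0 <= k h r <= 1) ->
    0 <= link_weight c1 c2 k m.
  by move=> q1 q2 kb; apply: wlim_ge0 => // h h' r r'; exact: kb.
have s12 := sum1 _ (fun m => m.1.1); have s23 := sum1 _ (fun m => m.1.2).
have s31 := sum1 _ snd.
have F12 := first_kernel_bounds pf12 pf21 b12 s12.
have G12 := second_kernel_bounds pf12 pf21 b12 s12.
have F23 := first_kernel_bounds pf23 pf32 b23 s23.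
have G23 := second_kernel_bounds pf23 pf32 b23 s23.
have F31 := first_kernel_bounds pf31 pf13 b31 s31.
have G31 := second_kernel_bounds pf31 pf13 b31 s31.
apply: (middle_entropy_ge Q_ge0 Q_total determines_x determines_y determines_z
  law_p12 law_p23 law_p31 law_p1 law_p2 law_p3
  (alice_weight_ge0 wfP) (bob_weight_ge0 wfP) (charlie_weight_ge0 wfP)
  _ _ _ _ _ _ _
  (kernel_split pf12 pf21 b12 s12 d12) (kernel_split pf23 pf32 b23 s23 d23)
  (kernel_split pf31 pf13 b31 s31 d31)) => //.
- by move=> a; apply: lw_ge0.
- by move=> a; apply: lw_ge0.
- by move=> a; apply: lw_ge0.
- by move=> a; apply: lw_ge0.
- by move=> a; apply: lw_ge0.
- by move=> a; apply: lw_ge0.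
- move=> x; apply: alice_check => //.
  + exact: (second_kernel_sum pf12 pf21 b12 s12).
  + exact: (first_kernel_sum pf31 pf13 b31 s31).
- move=> y; apply: bob_check => //.
  + exact: (second_kernel_sum pf23 pf32 b23 s23).
  + exact: (first_kernel_sum pf12 pf21 b12 s12).
- apply: charlie_check => //.
  + exact: (second_kernel_sum pf31 pf13 b31 s31).
  + exact: (first_kernel_sum pf23 pf32 b23 s23).
Qed.

Lemma p31_entropy :
  ((n%:R * ln 3)%:E <= \esum_(c in [set: word]) (p31 c * - ln (p31 c))%:E)%E.
Proof.
apply: (link_entropy_ge Q_ge0 Q_total determines_x determines_z (p2 := p2) (p23 := p23)).
- by move=> y w; exact: fin_ge0.
- exact: (p2_marginal Q_ge0 law_p23 law_p2).
- exact: law_p31.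
- by move=> x y m; apply: (marginal_ge Q_ge0 (law_p2 x y)).
- exact: (marginal_sum Q_ge0 Q_total (law_p23 z0 z0)).
Qed.

Let swap (m : M) : M := (m.1.1, m.2, m.1.2).

Let swap_law (V : choiceType) x y (U : M -> V) v :
  law (fun m => EQ x y (swap m)) (U \o swap) v = law (EQ x y) U v.
Proof.
rewrite !lawE; apply/esym.
rewrite (reindex_esum setT setT swap) //.
split=> //= [[[? ?] ?] [[? ?] ?] _ _ [-> -> ->] //|[[a b] c] _].
by exists (a, c, b).
Qed.

(** Exchanging Alice and Bob swaps Charlie's two links and preserves AND, so the bound for M31
    applies to the relabelled law [Q']. *)
Lemma p23_entropy :
  ((n%:R * ln 3)%:E <= \esum_(c in [set: word]) (p23 c * - ln (p23 c))%:E)%E.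
Proof.
pose Q' (y x : bits n) m := Q x y (swap m).
have Q'_total y x : (\esum_(m in [set: M]) (Q' y x m)%:E = 1)%E.
  have Q'0 m : (0 <= (Q' y x m)%:E)%E by rewrite lee_fin Q_ge0.
  rewrite -(esum_law (fun=> tt) Q'0) (esum_single (t := tt)); [|exact: law_ge0|by case].
  rewrite (swap_law x y (fun=> tt)) -(Q_total x y) -(esum_law (fun=> tt) (EQ_ge0 x y)).
  by rewrite (esum_single (t := tt)); [|exact: law_ge0|case].
apply: (@link_entropy_ge _ _ _ _ _ Q' p1 p31 p23) => //.
- by move=> y x m; exact: Q_ge0.
- by move=> y x y' x' a b b' c; exact: determines_y.
- move=> y x y' x' a a' b c H H'; rewrite ![AND y _]ANDC ![AND y' _]ANDC.
  exact: determines_z H H'.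
- by move=> x w; exact: fin_ge0.
- exact: (p1_marginal Q_ge0 law_p31 law_p1).
- by move=> y x c; rewrite -(law_p23 x y); exact: (swap_law x y (fun m => m.1.2)).
- by move=> y x [[a b] c]; apply: (marginal_ge Q_ge0 (law_p1 x y) (a, c, b)).
- exact: (marginal_sum Q_ge0 Q_total (law_p31 z0 z0)).
Qed.

(** This carries the bounds, found with uniform triples as inputs, over to the given [pXY]: a law
    common to all inputs is unchanged by averaging. *)
Lemma law_joint_const (V : choiceType) (U : outcome (bits n) (bits n) (bits n) -> V)
    (U' : M -> V) (p : V -> R) :
  (forall x y m, U (x, y, AND x y, m) = U' m) ->
  (forall x y v, law (EQ x y) U' v = (p v)%:E) -> forall v, law J U v = (p v)%:E.
Proof.
move=> UU' Up v; rewrite (law_joint wfP pXY_gt0 P_correct).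
have -> : p v = \sum_x \sum_y pXY x y * p v.
  by under eq_bigr do rewrite -mulr_suml; rewrite -mulr_suml pXY_sum mul1r.
rewrite -sumEFin; apply: eq_bigr => x _; rewrite -sumEFin; apply: eq_bigr => y _.
rewrite EFinM -(Up x y); congr (_ * law _ _ _)%E.
by apply/funext => m; rewrite UU'.
Qed.

Lemma marginal_bounds (V : choiceType) x y (U : M -> V) (p : V -> R) :
  (forall v, law (EQ x y) U v = (p v)%:E) -> forall v, 0 <= p v <= 1.
Proof.
move=> Up v; rewrite (marginal_ge0 Q_ge0 Up) -lee_fin -(marginal_sum Q_ge0 Q_total Up).
apply: (@le_esum_term _ _ (EFin \o p)) => i; rewrite lee_fin.
exact: (marginal_ge0 Q_ge0 Up).
Qed.

Lemma entropyE (U : outcome (bits n) (bits n) (bits n) -> word) (U' : M -> word)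
    (p : word -> R) :
  (forall x y m, U (x, y, AND x y, m) = U' m) ->
  (forall x y v, law (EQ x y) U' v = (p v)%:E) ->
  entropy J U = ((ln 2)^-1%:E * \esum_(v in [set: word]) (p v * - ln (p v))%:E)%E.
Proof.
move=> UU' Up; rewrite -esumZl.
- apply: eq_esum => v _; rewrite (law_joint_const UU' Up) /=.
  case: eqP => [->|_]; first by rewrite mul0r mule0.
  by rewrite -EFinM; congr EFin; rewrite /log2; ring.
- by rewrite invr_ge0 ln_ge0 // ler1n.
- move=> v; have /andP[p0 p1] := marginal_bounds (Up z0 z0) v.
  by rewrite lee_fin mulr_ge0 // oppr_ge0 ln_le0.
Qed.

Let oXY (o : outcome (bits n) (bits n) (bits n)) := (oX o, oY o).

Lemma law_inputs_M12 x y a :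
  law J (fun o => (oXY o, oM12 o)) ((x, y), a) = (pXY x y * p12 a)%:E.
Proof.
rewrite (law_joint wfP pXY_gt0 P_correct).
rewrite -(pair_sum (fun x y => (pXY x y * p12 a)%:E) x y).
apply: eq_bigr => x1 _; apply: eq_bigr => y1 _.
have mask (m : M) : ((oXY (x1, y1, AND x1 y1, m), oM12 (x1, y1, AND x1 y1, m))
    == ((x, y), a)) = ((x1 == x) && (y1 == y)) && (m.1.1 == a) by rewrite !xpair_eqE.
rewrite (law_mask (U' := fun m => m.1.1) _ mask) law_p12 EFinM.
by case: ifP; rewrite ?mule0.
Qed.

Lemma law_inputs x y : law J oXY (x, y) = (pXY x y)%:E.
Proof.
rewrite (law_joint wfP pXY_gt0 P_correct).
rewrite -(pair_sum (fun x y => (pXY x y)%:E) x y).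
apply: eq_bigr => x1 _; apply: eq_bigr => y1 _.
have mask (m : M) : (oXY (x1, y1, AND x1 y1, m) == (x, y))
    = ((x1 == x) && (y1 == y)) && (tt == tt) by rewrite xpair_eqE andbT.
rewrite (law_mask (U' := fun=> tt) _ mask) (law_const wfP P_terminates) eqxx.
by case: ifP; rewrite ?mule0 ?mule1.
Qed.

(* Given the inputs, the views determine the Alice-Bob transcript, which is
   independent of the inputs. *)
Lemma view_entropy_ge : (entropy J (@oM12 _ _ _) <= view_entropy pXY P)%E.
Proof.
have J0 := joint_ge0 (P := P) wfP pXY_gt0.
have pb : forall a, 0 <= p12 a <= 1 := marginal_bounds (law_p12 z0 z0).
pose g a := - log2 (p12 a).
have g0 a : 0 <= g a by rewrite oppr_ge0 log2_le0.
pose UW (o : outcome (bits n) (bits n) (bits n)) := ((oV1 o, oV2 o, oV3 o), oXY o).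
have -> : entropy J (@oM12 _ _ _) =
    (\esum_(o in [set: outcome (bits n) (bits n) (bits n)]) (J o * (g (oM12 o))%:E))%E.
  rewrite law_sum //; apply: eq_esum => a _.
  rewrite (law_joint_const (U' := fun m => m.1.1) (fun x y m => erefl) law_p12) /= -EFinM /g.
  by case: eqP => [->|_]; rewrite ?mul0r ?mulrN.
rewrite (law_sum (f := J) UW (g := fun uw => g uw.1.1.1.1.2)) //.
apply: le_esum => -[u [x y]] _.
have -> : law J UW (u, (x, y)) = (fine (law J UW (u, (x, y))))%:E.
  exact: (joint_law_fin wfP pXY_gt0 pXY_sum P_terminates P_correct).
set q := fine _; rewrite /= -/UW -/oXY law_inputs /= -/q -EFinM lee_fin.
have q0 : 0 <= q by rewrite fine_ge0 // law_ge0.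
case: eqP => [->|/eqP qn]; first by rewrite mul0r.
rewrite ler_wpM2l // /g.
have qp : 0 < q by rewrite lt_neqAle eq_sym qn.
set a := u.1.1.1.2.
(* The event fixing all views and inputs lies in the one fixing the inputs and M12, which are
   independent. So the conditional surprisal of the views is at least [- log2 (p12 a)]. *)
have qle : q <= pXY x y * p12 a.
  rewrite -lee_fin -law_inputs_M12.
  have -> : law J (fun o => (oXY o, oM12 o)) ((x, y), a)
      = law (law J UW) (fun uw => (uw.2, uw.1.1.1.1.2)) ((x, y), a) by rewrite law_comp.
  rewrite /q -(joint_law_fin wfP pXY_gt0 pXY_sum P_terminates P_correct).
  apply: (law_term (fun uw => (uw.2, uw.1.1.1.1.2)) (u, (x, y))).
  by move=> uw; exact: law_ge0.
have pa : 0 < p12 a.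
  by have := lt_le_trans qp qle; rewrite pmulr_rgt0.
have : ln q <= ln (pXY x y) + ln (p12 a) by rewrite -lnM ?posrE // ler_ln ?posrE // mulr_gt0.
rewrite /log2 ln_div ?posrE // -mulNr ler_pM2r ?invr_gt0 ?ln_gt0 ?ltr1n //.
lra.
Qed.

Lemma M31_entropy_ge : ((n%:R * log2 3)%:E <= entropy J (@oM31 _ _ _))%E.
Proof.
rewrite (entropyE (U' := snd) (fun x y m => erefl) law_p31) /log2 mulrA [_ / _]mulrC EFinM.
by apply: lee_wpmul2l p31_entropy; rewrite lee_fin invr_ge0 ln_ge0 // ler1n.
Qed.

Lemma M23_entropy_ge : ((n%:R * log2 3)%:E <= entropy J (@oM23 _ _ _))%E.
Proof.
rewrite (entropyE (U' := fun m => m.1.2) (fun x y m => erefl) law_p23).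
rewrite /log2 mulrA [_ / _]mulrC EFinM.
by apply: lee_wpmul2l p23_entropy; rewrite lee_fin invr_ge0 ln_ge0 // ler1n.
Qed.

Lemma M12_entropy_ge : ((n%:R * (log2 3 + 3^-1))%:E <= entropy J (@oM12 _ _ _))%E.
Proof.
have l2 : 0 < ln 2 :> R by rewrite ln_gt0 // ltr1n.
rewrite (entropyE (U' := fun m => m.1.1) (fun x y m => erefl) law_p12).
have -> : n%:R * (log2 3 + 3^-1) = (ln 2)^-1 * (n%:R * (ln 3 + ln 2 / 3)) :> R.
  by rewrite /log2; field; exact: lt0r_neq0.
by rewrite EFinM; apply: lee_wpmul2l p12_entropy; rewrite lee_fin invr_ge0 ltW.
Qed.

End component_AND.

(** Equivalent to 2^3 <= 3^2. *)
Lemma log2_3_ge (R : realType) : 3 / 2 <= log2 3 :> R.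
Proof.
have l2 : 0 < ln 2 :> R by rewrite ln_gt0 // ltr1n.
have : ln (2 ^+ 3) <= ln (3 ^+ 2) :> R by rewrite ler_ln ?posrE ?exprn_gt0 //; lra.
rewrite !lnXn // -[X in X <= _]mulr_natl -[X in _ <= X]mulr_natl.
by rewrite /log2 ler_pdivlMr //; lra.
Qed.

Theorem theorem8 (R : realType) (n : nat) (pXY : bits n -> bits n -> R) :
  (0 < n)%N ->
  (forall x y, 0 < pXY x y) ->
  \sum_(x : bits n) \sum_(y : bits n) pXY x y = 1 ->
  (forall P : protocol R (bits n) (bits n) (bits n),
     secure pXY (@AND n) P ->
     [/\ ((n%:R * log2 3)%:E <= entropy (joint pXY P) (@oM31 _ _ _))%E,
         ((n%:R * log2 3)%:E <= entropy (joint pXY P) (@oM23 _ _ _))%E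
       & ((1826%:R / 1000%:R * n%:R)%:E <= entropy (joint pXY P) (@oM12 _ _ _))%E])
  /\ ((1826%:R / 1000%:R * n%:R)%:E <= rho pXY (@AND n))%E.
Proof.
move=> _ pXY_gt0 pXY_sum.
have M12 P : secure pXY (@AND n) P ->
    ((1826%:R / 1000%:R * n%:R)%:E <= entropy (joint pXY P) (@oM12 _ _ _))%E.
  move=> sP; apply: le_trans (M12_entropy_ge pXY_gt0 pXY_sum sP).
  by rewrite lee_fin mulrC ler_wpM2l //; have := log2_3_ge R; lra.
split=> [P sP|].
  by split; [exact: M31_entropy_ge|exact: M23_entropy_ge|exact: M12].
apply/ereal_infP => _ [P [sP ->]].
exact: le_trans (M12 P sP) (view_entropy_ge pXY_gt0 pXY_sum sP).
Qed.
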